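(* Let $\alpha \ge 0$. Let $X$ be the number of cars that visit the root of a $\mathrm{BGW}(2,1/2)$ tree when an independent $\mathrm{Po}(\alpha)$ number of cars initially chooses each vertex. Write $p := \mathbb{P}(X=0)$ and let $G(s) := \mathbb{E}[s^X]$, $s \in [0,1]$, be the probability generating function of $X$. 1. For $0 \leq \alpha \leq 2 - \sqrt{2}$, for all $s\in[0,1]$, $$G(s) = 1 - \alpha - s(2 - \alpha) + 2s^2 e^{\alpha (1-s)} + 2s e^{\alpha (1-s)} \sqrt{s^2 - e^{\alpha (s-1)} \big(s(2 - \alpha) - (1-\alpha)\big)}.$$ Furthermore, $p = 1 - \alpha$ and $\mathbb{E}[X] = 2 - \alpha - \sqrt{2(\alpha^2 - 4\alpha + 2)}$. 2. For $\alpha > 2 - \sqrt{2}$, $$G(s) = p - s(1+p) + 2s^2 e^{\alpha (1-s)} + \begin{cases} 2s e^{\alpha (1-s)} \sqrt{s^2 - e^{\alpha (s-1)} (s(1+p) - p)}, & 0 \leq s \leq s_p, \\ - 2s e^{\alpha (1-s)} \sqrt{s^2 - e^{\alpha (s-1)} (s(1+p) - p)}, & s_p < s \leq 1, \end{cases}$$ where $$s_p = \frac{1 + (1+\alpha)p - \sqrt{(1 + (1+\alpha)p)^2 - 8\alpha p(1+p)}}{2\alpha(1+p)}.$$ Furthermore, $p > 1-\alpha$ and $\mathbb{E}[X] = \infty$. 3. If $\alpha > 2 - \sqrt{2}$, then $\max\left\{\frac{e^{-\alpha}}{4},\, 1 - \alpha\right\} < p < c(\alpha)$, where $$c(\alpha)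 := \begin{cases} \dfrac{(3 - 2\sqrt{2})\alpha - 1}{\alpha^2 - 6\alpha + 1} & \alpha \neq 3 + 2\sqrt{2}, \\[2mm] \dfrac{3\sqrt{2} - 4}{8} & \alpha = 3 + 2\sqrt{2}. \end{cases}$$
   Context: $\mathrm{BGW}(2,1/2)$ denotes the law of the family tree of a Galton–Watson branching process (started from a single root individual) with $\mathrm{Bin}(2,1/2)$ offspring distribution, i.e. each individual independently has $0,1,2$ children with probabilities $1/4,1/2,1/4$; this tree is almost surely finite. $\mathrm{Po}(\alpha)$ is the Poisson distribution with mean $\alpha$ (a point mass at $0$ if $\alpha=0$). The numbers of cars choosing the different vertices are independent $\mathrm{Po}(\alpha)$ given the tree. Parking process on a finite rooted tree: each vertex is a parking space holding at most one car. Cars arrive one by one, each at its chosen vertex. If that vertex is unoccupied the car parks there; otherwise it follows the unique path towards the root and parks at the first unoccupied vertex it encounters. If it finds none, it leaves the tree through the root. The number $X$ of cars that visit the root counts all cars that reach the root, whether they park there, pass through it, or initially choose it. Thus, writing $x^+=\max(x,0)$, the law of $X$ satisfies $$X \stackrel{d}{=} P + \sum_{i=1}^{N}(X_i-1)^+,$$ where $P\sim \mathrm{Po}(\alpha)$, $N\sim\mathrm{Bin}(2,1/2)$, and $X_1,X_2,\dots$ are copies of $X$, all independent. *)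

(* Defs.v *)
From mathcomp Require Import all_boot all_order all_algebra.
From mathcomp Require Import all_classical all_reals all_analysis.

Set Implicit Arguments.
Unset Strict Implicit.
Unset Printing Implicit Defensive.

Import Order.TTheory GRing.Theory Num.Theory.
Local Open Scope classical_set_scope.
Local Open Scope ring_scope.

(* Ulam-Harris words, written from the vertex up to the root: [::] is the root
   and i :: u is the i-th child of u (i = 0, 1, ...), so the parent is the
   tail. *)
Notation vertex := (seq nat).

(* Family tree of a branching process in which u has N u children. *)
Fixpoint in_tree (N : vertex -> nat) (u : vertex) : bool :=
  if u is i :: v then (i < N v)%N && in_tree N v else true.

(* [occ] lists the occupied vertices. *)

(* Vertices visited by a car arriving at u: it moves on to the parent exactly
   when the current vertex is occupied. *)
Fixpoint visited (occ : seq vertex) (u : vertex) : seq vertex :=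
  u ::
    (if u is _ :: v then if u \in occ then visited occ v else [::] else [::]).

(* The first unoccupied vertex among them becomes occupied; if there is none,
   the car leaves the tree. *)
Definition park (occ : seq vertex) (u : vertex) : seq vertex :=
  if [seq v <- visited occ u | v \notin occ] is v :: _ then v :: occ else occ.

(* Number of cars visiting the root when cars arrive at the successive vertices
   of s. *)
Fixpoint root_visits_from (occ : seq vertex) (s : seq vertex) : nat :=
  if s is u :: s' then
    ([::] \in visited occ u) + root_visits_from (park occ u) s'
  else 0%N.

Definition root_visits (s : seq vertex) : nat := root_visits_from [::] s.

(* s is an arrival order for the cars when C u cars choose the vertex u of the
   tree. *)
Definition arrival_order (N C : vertex -> nat) (s : seq vertex) : Prop :=
  forall u : vertex, count_mem u s = if in_tree N u then C u else 0%N.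

Definition mutually_independent d d' (Omega : measurableType d)
    (T : measurableType d') (R : realType) (P : probability Omega R)
    (I : eqType) (Y : I -> {RV P >-> T}) : Prop :=
  forall (J : seq I) (B : I -> set T),
    uniq J -> (forall i, measurable (B i)) ->
    P (\bigcap_(i in [set` J]) (Y i @^-1` B i)) =
    (\prod_(i <- J) P (Y i @^-1` B i))%E.

(* N u is the number of children and C u the number of cars attached to the
   word u.  [poisson_prob] takes a second argument that it ignores; it is the
   point mass at 0 when the rate is 0. *)
Record bgw_parking d (Omega : measurableType d) (R : realType)
    (P : probability Omega R) (alpha : R)
    (N C : vertex -> {RV P >-> nat}) : Prop := BGWParking {
  offspring_law : forall (u : vertex) (U : set nat),
    distribution P (N u) U = binomial_prob 2 (2^-1 : R) U ;
  cars_law : forall (u : vertex) (U : set nat),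
    distribution P (C u) U = poisson_prob alpha 0%N U ;
  offspring_cars_independent : mutually_independent
    (fun i : (vertex + vertex)%type =>
       match i with inl u => N u | inr u => C u end) }.

(* X counts the cars visiting the root, for some order of arrival, whenever the
   family tree is finite (an almost sure event); its values on the remaining
   null event are irrelevant. *)
Definition counts_root_visits d (Omega : measurableType d) (R : realType)
    (P : probability Omega R) (N C : vertex -> {RV P >-> nat})
    (X : {RV P >-> nat}) : Prop :=
  forall w : Omega, finite_set [set u | in_tree (fun v => N v w) u] ->
    exists2 s : seq vertex,
      arrival_order (fun u => N u w) (fun u => C u w) s &
      X w = root_visits s.

Section constants.
Context {R : realType}.
Implicit Types alpha p : R.

Definition s_discr alpha p : R :=
  (1 + (1 + alpha) * p) ^+ 2 - 8 * alpha * p * (1 + p).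

Definition s_crit alpha p : R :=
  (1 + (1 + alpha) * p - Num.sqrt (s_discr alpha p)) / (2 * alpha * (1 + p)).

Definition c_bound alpha : R :=
  if alpha == 3 + 2 * Num.sqrt 2 then (3 * Num.sqrt 2 - 4) / 8
  else ((3 - 2 * Num.sqrt 2) * alpha - 1) / (alpha ^+ 2 - 6 * alpha + 1).

End constants.

(* Main.v *)
Require Import Defs.
From mathcomp Require Import all_boot all_order all_algebra.
From mathcomp Require Import all_classical all_reals all_analysis.
From mathcomp Require Import measurable_realfun ring lra.
Import Order.TTheory GRing.Theory Num.Theory numFieldNormedType.Exports.
Local Open Scope classical_set_scope.
Local Open Scope ring_scope.

(* The final configuration does not depend on the order of arrival: a vertex is
   visited by its own cars and by all but the first of the visitors of each
   child. Truncating the tree at depth n makes the number of visits to the root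
   a function of finitely many independent variables, whose generating function
   obeys a recursion in n. The critical tree reaches depth n with probability at
   most 4 / (n + 4), so letting n grow gives, for G(s) = E s^X and p = G(0),

     4 s^2 G(s) = e^(alpha (s - 1)) (G(s) - p + s (1 + p))^2.

   This quadratic in G(s) has discriminant proportional to the square of a
   continuous function of s (called [branch] below), positive near 0, and only
   its sign on (0, 1) is in question. At an interior zero of the radicand the
   ratio (s (1 + p) - p) e^(alpha (s - 1)) / s^2 reaches its maximum 1, which it
   also takes at s = 1; hence its derivative vanishes there (Fermat) and once
   more before 1 (Rolle). The numerator of the derivative is a quadratic
   polynomial, so the zero is its smaller root [s_crit]. If p > 1 - alpha, then
   G <= 1 forces the sign to be negative near 1 and the slope of G at 1 to be
   infinite, so there is such a zero. If alpha <= 2 - sqrt 2 the quadratic is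
   positive on (0, 1), so p = 1 - alpha; otherwise p = 1 - alpha would make the
   radicand negative near 1. The bound p < c(alpha) expresses that the
   discriminant of the quadratic is positive. *)

(** * Parking is independent of the order of arrival *)

Section parking_combinatorics.
Local Open Scope nat_scope.

(** Visits are counted at an arbitrary vertex, because the recursion on the tree passes from a
    vertex to its children. *)
Fixpoint visits_from (v : vertex) (occ : seq vertex) (s : seq vertex) : nat :=
  if s is u :: s' then
    (v \in visited occ u) + visits_from v (park occ u) s'
  else 0.

Lemma root_visitsE s : root_visits s = visits_from [::] [::] s.
Proof.
rewrite /root_visits; elim: s [::] => //= u s IHs occ.
by rewrite IHs.
Qed.

Lemma visited_suffix occ u v : v \in visited occ u -> suffix v u.
Proof.
elim: u => [|i u IHu] /=; first by rewrite inE => /eqP ->.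
rewrite inE => /orP[/eqP ->|]; first exact: suffix_refl.
case: ifP => // _ /IHu /suffixP[t ->].
by apply/suffixP; exists (i :: t).
Qed.

(** A car moves on only from occupied vertices, so at most the last visited vertex was free, and
    that is where it parks. *)
Lemma mem_park occ u x : (x \in park occ u) = (x \in occ) || (x \in visited occ u).
Proof.
elim: u => [|i u IHu].
  rewrite /park /=; case: ifP => [|/negbFE]; rewrite !inE; first by rewrite orbC.
  by move=> o; case: eqP => [->|]; rewrite ?orbT ?orbF ?o.
rewrite /park /=; case: ifP => [io|/negbFE io].
  by rewrite (negbTE io) /= !inE orbC.
rewrite io inE -[RHS]/(_ || (_ || _)) orbCA -IHu /park.
by case: eqP => //= ->; case: [seq _ <- _ | _] => [|y t]; rewrite ?inE io ?orbT.
Qed.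

(** A car visits [v] either because it starts there or because it comes from exactly one child,
    found occupied. The bound [k] on the letters of [u] makes the sum range over enough children. *)
Lemma visited_child occ k u v : all (gtn k) u ->
  (v \in visited occ u : nat) =
  (u == v) + \sum_(i < k) ((nat_of_ord i :: v \in visited occ u) && (nat_of_ord i :: v
    \in occ)).
Proof.
elim: u => [_|j u IHu].
  rewrite /= inE eq_sym big1 ?addn0// => i _; by rewrite inE.
move=> /andP[jk /IHu {}IHu].
have long w : v = j :: u -> (w :: v \in visited occ (j :: u)) = false.
  by move=> ->; apply/negP => /visited_suffix/size_suffix; rewrite ltnn.
have [ev|ne] := eqVneq v (j :: u).
  rewrite big1 => [|i _]; last by rewrite long.
  by rewrite ev inE eqxx.
rewrite /=.
rewrite inE (negbTE ne) /= add0n.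
case: ifP => jo; last first.
  by rewrite big1 // => i _; rewrite !inE; case: eqP => //= ->; rewrite jo.
rewrite IHu.
have [uv|nu] := eqVneq u v.
  subst v.
  rewrite [RHS](bigD1 (Ordinal jk)) //= inE eqxx jo /=.
  congr addn.
  have z (i : 'I_k) : (nat_of_ord i :: u \in visited occ u) = false.
    by apply/negP => /visited_suffix/size_suffix/=; rewrite ltnn.
  rewrite big1 ?big1 // => i; last by rewrite z.
  by rewrite inE z orbF eqseq_cons eqxx andbT -val_eqE /= => /negbTE ->.
rewrite [LHS]add0n; apply: eq_bigr => i _.
by rewrite inE eqseq_cons [v == u]eq_sym (negbTE nu) andbF.
Qed.

(* A vertex stays occupied from its first visitor on, and every later visitor
   moves on to the parent. *)
Lemma visits_from_child v occ k s : all (all (gtn k)) s ->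
  visits_from v occ s = count_mem v s +
  \sum_(i < k) if nat_of_ord i :: v \in occ then visits_from (nat_of_ord i :: v) occ s
    else (visits_from (nat_of_ord i :: v) occ s).-1.
Proof.
elim: s occ => [|u s IHs] occ /=.
  by move=> _; rewrite big1// => i _; case: ifP.
move=> /andP[uk /IHs ->]; rewrite (visited_child _ _ _ _ uk).
rewrite -!addnA; congr addn.
rewrite addnCA; congr addn.
rewrite -big_split /=; apply: eq_bigr => i _.
rewrite mem_park.
by do 2 case: (_ \in _) => /=.
Qed.

Lemma in_tree_suffix N u v : suffix v u -> in_tree N u -> in_tree N v.
Proof. by move=> /suffixP[t ->]; elim: t => //= i t IHt /andP[_]. Qed.

Lemma visits_from_notin N s v occ : all (in_tree N) s -> ~~ in_tree N v ->
  visits_from v occ s = 0.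
Proof.
move=> + nv; elim: s occ => //= u s IHs occ /andP[Nu /IHs ->].
rewrite addn0; case: (boolP (v \in _)) => // /visited_suffix/in_tree_suffix.
by move=> /(_ N Nu); rewrite (negbTE nv).
Qed.

(* The children beyond the second are ignored: binomial(2, 1/2) offspring
   produces none almost surely. *)
Fixpoint tree_rec (z0 : nat) (c t : nat -> nat) (N C : vertex -> nat) (n : nat)
    (v : vertex) : nat :=
  if n is m.+1 then
    c (C v) + (0 < N v) * t (tree_rec z0 c t N C m (0 :: v))
            + (1 < N v) * t (tree_rec z0 c t N C m (1 :: v))
  else z0.

(** No car comes from generation [n] ([z0 = 0]), and [predn] is the map sending [x] to the positive
    part of [x - 1]. *)
Definition truncated_visits := tree_rec 0 id predn.
(** With no cars, lossless transmission and the value 1 at the bottom, the same recursion counts the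
    descendants [n] generations below [v]. *)
Definition generation_size := tree_rec 1 (fun=> 0) id.

Variables (N C : vertex -> nat).
Hypothesis N2 : forall u, N u <= 2.

(** The subtree at [v] consists of [v] and of the subtrees of its finitely many children, whose
    generation [n - 1] is empty as well. *)
Lemma finite_subtree n v : generation_size N C n v = 0 ->
  finite_set [set u | suffix v u && in_tree N u].
Proof.
elim: n v => // n IHn v /=.
rewrite /generation_size /= -/(generation_size) add0n.
move=> /eqP; rewrite addn_eq0 !muln_eq0 !eqb0 => /andP[f0 f1].
have fin i : i < N v -> finite_set [set u | suffix (i :: v) u && in_tree N u].
  move=> iN; have /IHn// : generation_size N C n (i :: v) = 0.
  have : i < 2 by exact: leq_trans iN (N2 v).
  case: i iN => [|[|//]] iN _.
    by move: f0; rewrite iN => /eqP.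
  by move: f1; rewrite iN => /eqP.
have finU : finite_set ([set v] `|` \bigcup_(i in `I_(N v)) [set u | suffix (i :: v) u
  && in_tree N u]).
  rewrite finite_setU; split; first exact: finite_set1.
  by apply: bigcup_finite => // i /fin.
apply: sub_finite_set finU => u /= /andP[/suffixP[t ->]].
(* Words run up to the root, so the last letter of [t] names the child of [v] through which [u]
   descends. *)
elim/last_ind: t => [|t i _]; first by left.
rewrite -cats1 -catA /= => tN; right; exists i => /=; last by rewrite suffix_suffix.
by have /= /andP[] := @in_tree_suffix N _ _ (suffix_suffix t (i :: v)) tN.
Qed.

(** When generation [n] below [v] is empty the truncation cuts nothing, and [visits_from_child],
    started with no vertex occupied, is the recursion defining [truncated_visits]. *)
Lemma truncated_visitsE s n v : arrival_order N C s -> in_tree N v ->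
  generation_size N C n v = 0 -> visits_from v [::] s = truncated_visits N C n v.
Proof.
move=> arr.
have sN : all (in_tree N) s.
  apply/allP => u us; have := arr u; case: ifP => // _ /eqP.
  by rewrite -leqn0 leqNgt -has_count has_pred1 us.
elim: n v => // n IHn v Nv /=.
rewrite /generation_size /= -/(generation_size) add0n.
rewrite /truncated_visits /= -/(truncated_visits).
move=> /eqP; rewrite addn_eq0 !muln_eq0 !eqb0 => /andP[f0 f1].
have sN2 : all (all (gtn 2)) s.
  apply: sub_all sN => u; elim: u => //= i u IHu /andP[iN /IHu ->].
  by rewrite andbT (leq_trans iN).
rewrite (visits_from_child _ _ _ _ sN2) arr Nv !big_ord_recl big_ord0 /= addn0 -addnA.
(* For an absent child both sides are 0, since no car starts outside the tree. *)
have vE i : i < 2 -> ((i < N v) ==> (generation_size N C n (i :: v) == 0)) ->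
    (visits_from (i :: v) [::] s).-1 =
    (i < N v) * (truncated_visits N C n (i :: v)).-1.
  move=> i2; case: (boolP (i < N v)) => [iN /eqP|iN _].
    by rewrite mul1n => /IHn ->//=; rewrite iN.
  by rewrite (visits_from_notin _ _ _ _ sN) //= (negbTE iN).
congr addn; congr addn.
  by apply: vE => //; rewrite implybE.
by apply: vE => //; rewrite implybE.
Qed.

End parking_combinatorics.

(** * Independence *)

(** Measurability with respect to the variables in [K], stated pointwise: a finite family of natural
    numbers takes countably many values, so no sigma-algebra is involved. *)
Definition depends_on {Omega : Type} {I : eqType} (Y : I -> Omega -> nat) {T : Type}
    (K : seq I) (f : Omega -> T) : Prop :=
  forall w w', {in K, forall i, Y i w = Y i w'} -> f w = f w'.

Section depends_on_theory.
Context {Omega : Type} {I : eqType} {Y : I -> Omega -> nat}.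

(* The values of the variables indexed by [K], encoded as one natural number. *)
Definition config (K : seq I) (w : Omega) : nat := pickle [seq Y i w | i <- K].

Lemma eq_config K w w' : config K w = config K w' <-> {in K, forall i, Y i w = Y i w'}.
Proof.
split; last by move=> /eq_in_map e; rewrite /config e.
by move=> /(pcan_inj pickleK) /eq_in_map.
Qed.

Lemma depends_on_config {R : realType} K (f : Omega -> R) : depends_on Y K f ->
  (forall w, 0 <= f w) ->
  exists2 g : nat -> R, (forall n, 0 <= g n) & f = g \o config K.
Proof.
(* Codes outside the range of [config K] receive the default value 0. *)
move=> fK f0; exists (fun n => if pselect (exists w, config K w = n) is left e
  then f (sval (cid e)) else 0).
  by move=> n; case: pselect.
apply/funext => w /=; case: pselect => [e|]; last by case; exists w.
by case: cid => w' /= /eq_config/fK ->.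
Qed.

Lemma depends_on_sub {T : Type} (K L : seq I) (f : Omega -> T) :
  {subset K <= L} -> depends_on Y K f -> depends_on Y L f.
Proof. by move=> KL fK w w' e; apply: fK => i /KL /e. Qed.

End depends_on_theory.
Arguments config {Omega I} Y K w.

(** * Integrals decomposed along the values of a natural-number variable *)

Section nat_valued.
Context {d : measure_display} {Omega : measurableType d} {R : realType}
  (P : probability Omega R) (T : Omega -> nat).
Hypothesis mT : forall n, measurable [set w | T w = n].

Lemma measurable_natfun {d'} {U : measurableType d'} (g : nat -> U) :
  measurable_fun setT (g \o T).
Proof.
apply: measurableT_comp => //.
move=> _ V _; rewrite setTI.
rewrite (_ : T @^-1` V = \bigcup_(n in V) [set w | T w = n]).
  by apply: bigcup_measurable.
by apply/seteqP; split => [w Vw|w [n Vn /= e]]; [exists (T w)|rewrite /= e].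
Qed.

Lemma ge0_integral_natfun (D : set Omega) (h : Omega -> \bar R) : measurable D ->
  measurable_fun setT h -> (forall w, (0 <= h w)%E) ->
  (\int[P]_(w in D) h w =
   \sum_(n <oo) \int[P]_(w in D `&` [set w | T w = n]) h w)%E.
Proof.
move=> mD mh h0.
have DE : D = \bigcup_n (D `&` [set w | T w = n]).
  by apply/seteqP; split => [w Dw|w [n _ []]//]; exists (T w).
rewrite {1}DE ge0_integral_bigcup//.
- by move=> n; exact: measurableI.
- exact: measurable_funTS.
- by move=> m n _ _ [w /= [[_ <-] [_ <-]]].
Qed.

Lemma integral_natfun (D : set Omega) (g : nat -> R) :
  measurable D -> (forall n, 0 <= g n) ->
  (\int[P]_(w in D) (g (T w))%:E =
   \sum_(n <oo) (g n)%:E * P (D `&` [set w | T w = n]))%E.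
Proof.
move=> mD g0; rewrite (ge0_integral_natfun D)//; last 2 first.
- exact/measurable_EFinP/measurable_natfun.
- by move=> w; rewrite lee_fin.
apply: eq_eseriesr => n _.
have mDn : measurable (D `&` [set w | T w = n]) by exact: measurableI.
rewrite -(integral_cst _ mDn); apply: eq_integral => w.
by rewrite inE => -[_ /= ->].
Qed.

End nat_valued.
Arguments ge0_integral_natfun {d Omega R} P {T}.
Arguments integral_natfun {d Omega R} P {T}.

Section independence.
Context {d : measure_display} {Omega : measurableType d} {R : realType}
  {P : probability Omega R} {I : eqType} (Y : I -> {RV P >-> nat}).
Hypothesis indY : mutually_independent Y.

Let YY i : Omega -> nat := Y i.

(** This presents an atom as an intersection of events about single variables, the form to which
    mutual independence applies. *)
Lemma atomE K w0 : [set w | config YY K w = config YY K w0] =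
  \bigcap_(i in [set` K]) (Y i @^-1` [set Y i w0]).
Proof.
apply/seteqP; split => w /=.
  by move=> /eq_config e i /= /e.
by move=> e; apply/eq_config => i /e.
Qed.

Lemma measurable_config K n : measurable [set w | config YY K w = n].
Proof.
have [[w0 <-]|nex] := pselect (exists w, config YY K w = n); last first.
  rewrite (_ : [set _ | _] = set0)//; apply/seteqP; split=> // w /= e.
  by apply: nex; exists w.
rewrite atomE; apply: fin_bigcap_measurable => // i _.
exact: measurable_funPTI.
Qed.

Lemma measurable_depends K (f : Omega -> R) : depends_on YY K f ->
  (forall w, 0 <= f w) -> measurable_fun setT f.
Proof.
move=> fK f0; have [g g0 ->] := depends_on_config _ _ fK f0.
exact/measurable_natfun/measurable_config.
Qed.

Lemma probability_atomI K L m n : uniq K -> uniq L -> ~~ has (mem K) L ->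
  P ([set w | config YY K w = m] `&` [set w | config YY L w = n]) =
  (P [set w | config YY K w = m] * P [set w | config YY L w = n])%E.
Proof.
move=> uK uL KL.
have [[w0 <-]|nex] := pselect (exists w, config YY K w = m); last first.
  rewrite (_ : [set w | config YY K w = m] = set0) ?set0I ?measure0 ?mul0e//.
  by apply/seteqP; split=> // w /= e; apply: nex; exists w.
have [[w1 <-]|nex] := pselect (exists w, config YY L w = n); last first.
  rewrite (_ : [set w | config YY L w = n] = set0) ?setI0 ?measure0 ?mule0//.
  by apply/seteqP; split=> // w /= e; apply: nex; exists w.
(* Gluing the two prescriptions allows one application of mutual independence, over [K ++ L]. *)
pose B i := if i \in K then [set Y i w0] else [set Y i w1].
have BK : [set w | config YY K w = config YY K w0] =
    \bigcap_(i in [set` K]) (Y i @^-1` B i).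
  by rewrite atomE; apply: eq_bigcapr => i /=; rewrite /B => ->.
have BL : [set w | config YY L w = config YY L w1] =
    \bigcap_(i in [set` L]) (Y i @^-1` B i).
  rewrite atomE; apply: eq_bigcapr => i /= iL; rewrite /B ifN//.
  by apply: contra KL => iK; apply/hasP; exists i.
have mB i : measurable (B i) by [].
have uKL : uniq (K ++ L) by rewrite cat_uniq uK KL.
have BKL : [set w | config YY K w = config YY K w0] `&`
    [set w | config YY L w = config YY L w1] =
    \bigcap_(i in [set` K ++ L]) (Y i @^-1` B i).
  rewrite BK BL -bigcap_setU; congr bigcap.
  by apply/seteqP; split => i /=; rewrite mem_cat => /orP.
by rewrite BKL BK BL !indY// big_cat.
Qed.

(** Both integrals are decomposed over the countably many atoms of [K] and of [L], where
    independence is [probability_atomI]. *)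
Lemma integral_indep K L (f g : Omega -> R) : ~~ has (mem K) L ->
  depends_on YY K f -> depends_on YY L g ->
  (forall w, 0 <= f w) -> (forall w, 0 <= g w) ->
  (\int[P]_w (g w)%:E \is a fin_num)%E ->
  (\int[P]_w (f w * g w)%:E = \int[P]_w (f w)%:E * \int[P]_w (g w)%:E)%E.
Proof.
move=> KL.
(* Mutual independence is stated for duplicate-free lists of indices. *)
have undupK J (h : Omega -> R) : depends_on YY J h -> depends_on YY (undup J) h.
  by apply: depends_on_sub => i; rewrite mem_undup.
have {KL} : ~~ has (mem (undup K)) (undup L).
  apply: contra KL => /hasP[i]; rewrite mem_undup => iL /=; rewrite mem_undup => iK.
  by apply/hasP; exists i.
move: (undup_uniq K) (undup_uniq L) => uK uL KL /undupK fK /undupK gL.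
move: {undupK K L} (undup K) (undup L) uK uL KL fK gL => K L uK uL KL fK gL f0 g0 gfin.
have mf := measurable_depends _ _ fK f0; have mg := measurable_depends _ _ gL g0.
have [f' f'0 fE] := depends_on_config _ _ fK f0.
have [g' g'0 gE] := depends_on_config _ _ gL g0.
have atom m : (\int[P]_(w in [set w | config YY K w = m]) (g w)%:E =
    P [set w | config YY K w = m] * \int[P]_w (g w)%:E)%E.
  rewrite gE (integral_natfun P (measurable_config L))//; last exact: measurable_config.
  rewrite (integral_natfun P (measurable_config L))// -(fineK (fin_num_measure P _
    (measurable_config K m))).
  rewrite -nneseriesZl; last first.
    by move=> n _; rewrite mule_ge0 ?lee_fin.
  by apply: eq_eseriesr => n _; rewrite probability_atomI// setTI muleCA fineK//
    fin_num_measure//; exact: measurable_config.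
rewrite (ge0_integral_natfun P (measurable_config K) setT)//; last 2 first.
- exact/measurable_EFinP/measurable_funM.
- by move=> w; rewrite lee_fin mulr_ge0.
rewrite muleC {2}fE (integral_natfun P (measurable_config K))// -(fineK gfin)
  -nneseriesZl; last first.
  by move=> n _; rewrite mule_ge0 ?lee_fin.
apply: eq_eseriesr => n _; rewrite setTI.
rewrite (fineK gfin) [in RHS]muleCA [in X in (_ * X)%E]muleC -atom.
rewrite -ge0_integralZl//.
- by apply: eq_integral => w; rewrite inE /= => wn; rewrite fE /= wn EFinM.
- exact: measurable_config.
- exact/measurable_EFinP/measurable_funTS.
- by move=> w _; rewrite lee_fin.
- by rewrite lee_fin.
Qed.
End independence.

(** A real-valued expectation, open to real arithmetic; for variables with values in [0, 1] the
    integral is finite and [fine] loses nothing. *)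
Definition mean {d} {Omega : measurableType d} {R : realType}
    (P : probability Omega R) (f : Omega -> R) : R :=
  fine (\int[P]_w (f w)%:E).

Section mean_theory.
Context {d : measure_display} {Omega : measurableType d} {R : realType}
  {P : probability Omega R}.
Implicit Types f g : Omega -> R.

Lemma integral_cst1 (r : R) : (\int[P]_w r%:E)%E = r%:E.
Proof. by rewrite integral_cst// [X in (_ * X)%E]probability_setT mule1. Qed.

Lemma mean_cst (r : R) : mean P (fun=> r) = r.
Proof. by rewrite /mean integral_cst1. Qed.

Lemma integral_mean f : measurable_fun setT f -> (forall w, 0 <= f w <= 1) ->
  (\int[P]_w (f w)%:E)%E = (mean P f)%:E.
Proof.
move=> mf f01; rewrite /mean fineK// ge0_fin_numE; last first.
  by apply: integral_ge0 => w _; rewrite lee_fin; case/andP: (f01 w).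
apply: (@le_lt_trans _ _ (\int[P]_w 1%:E)%E); last by rewrite integral_cst1 ltry.
apply: ge0_le_integral => //.
- by move=> w _; rewrite lee_fin; case/andP: (f01 w).
- exact/measurable_EFinP.
- by move=> w _; rewrite lee_fin; case/andP: (f01 w).
Qed.

Lemma ler_mean f g : measurable_fun setT f -> measurable_fun setT g ->
  (forall w, 0 <= f w <= 1) -> (forall w, 0 <= g w <= 1) ->
  {ae P, forall w, f w <= g w} -> mean P f <= mean P g.
Proof.
move=> mf mg f01 g01 fg; rewrite -lee_fin -!integral_mean//.
apply: ae_ge0_le_integral => //.
- by move=> w _; rewrite lee_fin; case/andP: (f01 w).
- exact/measurable_EFinP.
- by move=> w _; rewrite lee_fin; case/andP: (g01 w).
- exact/measurable_EFinP.
- by apply: filterS fg => w fgw _; rewrite lee_fin.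
Qed.

Lemma eq_mean f g : f =1 g -> mean P f = mean P g.
Proof. by move=> /funext ->. Qed.

Lemma meanD f g : measurable_fun setT f -> measurable_fun setT g ->
  (forall w, 0 <= f w <= 1) -> (forall w, 0 <= g w <= 1) ->
  mean P (fun w => f w + g w) = mean P f + mean P g.
Proof.
move=> mf mg f01 g01; rewrite /mean.
under eq_integral do rewrite EFinD.
rewrite ge0_integralD//.
- by rewrite !integral_mean.
- by move=> w _; rewrite lee_fin; case/andP: (f01 w).
- exact/measurable_EFinP.
- by move=> w _; rewrite lee_fin; case/andP: (g01 w).
- exact/measurable_EFinP.
Qed.

Lemma meanZ (r : R) f : measurable_fun setT f -> (forall w, 0 <= f w <= 1) -> 0 <= r ->
  mean P (fun w => r * f w) = r * mean P f.
Proof.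
move=> mf f01 r0; rewrite /mean.
under eq_integral do rewrite EFinM.
rewrite ge0_integralZl//.
- by rewrite integral_mean.
- exact/measurable_EFinP.
- by move=> w _; rewrite lee_fin; case/andP: (f01 w).
Qed.

Lemma mean_itv f : measurable_fun setT f -> (forall w, 0 <= f w <= 1) ->
  0 <= mean P f <= 1.
Proof.
move=> mf f01; rewrite -{1}(mean_cst 0) -(mean_cst 1); apply/andP; split.
  apply: ler_mean => //; first by move=> _; rewrite lexx ler01.
  by apply: aeW => w; case/andP: (f01 w).
apply: ler_mean => //; first by move=> _; rewrite lexx ler01.
by apply: aeW => w; case/andP: (f01 w).
Qed.

Context {I : eqType} (Y : I -> {RV P >-> nat}).
Hypothesis indY : mutually_independent Y.

Lemma mean_indep K L f g : ~~ has (mem K) L ->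
  depends_on Y K f -> depends_on Y L g ->
  (forall w, 0 <= f w <= 1) -> (forall w, 0 <= g w <= 1) ->
  mean P (fun w => f w * g w) = mean P f * mean P g.
Proof.
move=> KL fK gL f01 g01.
have f0 w : 0 <= f w by case/andP: (f01 w).
have g0 w : 0 <= g w by case/andP: (g01 w).
have mf := measurable_depends Y K f fK f0.
have mg := measurable_depends Y L g gL g0.
by rewrite /mean (integral_indep Y indY K L)// !integral_mean// .
Qed.

End mean_theory.

(** * Recursion at finite depth *)

(** The variables read by [tree_rec] at depth [n]; like it, the list follows only the first two
    children. *)
Fixpoint tree_idx (n : nat) (v : vertex) : seq (vertex + vertex) :=
  if n is m.+1 then
    inl v :: inr v :: tree_idx m (0%N :: v) ++ tree_idx m (1%N :: v)
  else [::].

Definition idx_vertex (i : vertex + vertex) : vertex :=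
  match i with inl u | inr u => u end.

Lemma tree_idx_suffix n v i : i \in tree_idx n v -> suffix v (idx_vertex i).
Proof.
elim: n v => // n IHn v; rewrite !inE mem_cat => /or4P[/eqP->|/eqP->|/IHn|/IHn];
  rewrite ?suffix_refl//; apply: suffix_trans; exact: (suffix_suffix [:: _]).
Qed.

Lemma notin_tree_idx n v j i : idx_vertex i = v -> (i \in tree_idx n (j :: v)) = false.
Proof.
move=> iv; apply/negP => /tree_idx_suffix/size_suffix.
by rewrite iv /= ltnn.
Qed.

(** A word has only one suffix of a given length, so it cannot end both in [0 :: v] and in
    [1 :: v]. *)
Lemma disjoint_tree_idx m n v : ~~ has (mem (tree_idx m (0%N :: v))) (tree_idx n (1%N
  :: v)).
Proof.
apply/hasP => -[i /tree_idx_suffix + /tree_idx_suffix].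
rewrite !suffixE /= => /eqP e0 /eqP; rewrite e0; discriminate.
Qed.

Section tree_recursion.
Context {d : measure_display} {Omega : measurableType d} {R : realType}
  {P : probability Omega R} {alpha : R}.
Variables N C : vertex -> {RV P >-> nat}.
Hypothesis alpha_ge0 : 0 <= alpha.
Hypothesis NC : bgw_parking alpha N C.

Let Y (i : vertex + vertex) : {RV P >-> nat} :=
  match i with inl u => N u | inr u => C u end.

Let indY : mutually_independent Y := offspring_cars_independent NC.

Lemma measurable_RVnat (T : {RV P >-> nat}) n : measurable [set w | T w = n].
Proof.
rewrite (_ : [set w | _] = T @^-1` [set n])//.
exact: measurable_funPTI.
Qed.

Lemma offspring_prob v n : P [set w | N v w = n] =
  (binomial_pmf 2 2^-1 n)%:E.
Proof.
have := offspring_law NC v [set n]; rewrite /distribution /pushforward => ->.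
rewrite /binomial_prob ifT ?esum_set1// ?lee_fin ?binomial_pmf_ge0//; lra.
Qed.

Lemma offspring_le2 v : {ae P, forall w, (N v w <= 2)%N}.
Proof.
exists [set w | (2 < N v w)%N]; split; last by move=> w /= /negP; rewrite -ltnNge.
- rewrite (_ : [set w | _] = N v @^-1` [set n | (2 < n)%N])//.
  exact: measurable_funPTI.
- have := offspring_law NC v [set n | (2 < n)%N].
  rewrite /distribution /pushforward => ->.
  rewrite /binomial_prob ifT; last lra.
  by apply: esum1 => n /= n2; rewrite /binomial_pmf bin_small.
Qed.

Lemma mean_offspring v (g : nat -> R) : (forall n, 0 <= g n <= 1) ->
  mean P (fun w => g (N v w)) = g 0%N / 4 + g 1%N / 2 + g 2 / 4.
Proof.
move=> g01; have g0 n : 0 <= g n by case/andP: (g01 n).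
rewrite /mean (integral_natfun P (measurable_RVnat (N v)))//.
under eq_eseriesr do rewrite setTI offspring_prob -EFinM.
rewrite (nneseries_split 0 3); last first.
  by move=> k _; rewrite lee_fin mulr_ge0// binomial_pmf_ge0//; lra.
rewrite eseries0 ?adde0; last first.
  by move=> k k3 _; rewrite /binomial_pmf bin_small// mulr0.
rewrite !big_nat_recr//= big_nil /binomial_pmf /unstable.onem /=.
by rewrite !bin0 !bin1 binn !mulr1n; field.
Qed.

Lemma mean_cars v (s : R) : 0 <= s <= 1 ->
  mean P (fun w => s ^+ C v w) = expR (alpha * (s - 1)).
Proof.
move=> /andP[s0 s1].
rewrite /mean (integral_natfun P (measurable_RVnat (C v)) _ (fun n => s ^+ n))//;
  last first.
  by move=> n; rewrite exprn_ge0.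
have cP n : P (setT `&` [set w | C v w = n]) = ((alpha ^+ n / n`!%:R) * expR (-
  alpha))%:E.
  rewrite setTI; have := cars_law NC v [set n].
  rewrite /distribution /pushforward => ->; rewrite /poisson_prob.
  have [a0|] := ltP 0 alpha.
    by rewrite esum_set1 /poisson_pmf ?a0// lee_fin mulr_ge0 ?mulr_ge0 ?exprn_ge0
      ?expR_ge0.
  (* At rate 0 the law is a point mass, which agrees with the Poisson weights because
     [0 ^+ 0 = 1]. *)
  move=> a_le0; have -> : alpha = 0 by apply/eqP; rewrite eq_le a_le0.
  rewrite oppr0 expR0 mulr1 diracE.
  case: n => [|n]; first by rewrite mem_set//= expr0 fact0 divr1.
  by rewrite expr0n /= mul0r memNset.
have tE n : ((s ^+ n)%:E * P (setT `&` [set w | C v w = n]) =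
    (expR (- alpha))%:E * ((alpha * s) ^+ n / n`!%:R)%:E)%E.
  by rewrite cP -!EFinM exprMn; congr (_%:E); ring.
under eq_eseriesr do rewrite tE.
rewrite nneseriesZl; last first.
  by move=> n _; rewrite lee_fin mulr_ge0 ?exprn_ge0 ?mulr_ge0.
rewrite (_ : (\sum_(_ <= _ <oo) _)%E = (expR (alpha * s))%:E).
  by rewrite -EFinM /= -expRD; congr expR; ring.
rewrite -EFin_lim; last exact: is_cvg_series_exp_coeff.
by apply/congr_lim/funext => n; rewrite /series /= -sumEFin.
Qed.

Definition tree_var z0 c t n v (w : Omega) : nat :=
  tree_rec z0 c t (fun u => N u w) (fun u => C u w) n v.

Lemma depends_tree_var z0 c t n v :
  depends_on Y (tree_idx n v) (tree_var z0 c t n v).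
Proof.
rewrite /tree_var; elim: n v => // n IHn v w w' e /=.
rewrite (IHn (0%N :: v) w w'); last first.
  by move=> i iK; apply: e; rewrite !inE mem_cat iK !orbT.
rewrite (IHn (1%N :: v) w w'); last first.
  by move=> i iK; apply: e; rewrite !inE mem_cat iK !orbT.
have -> : N v w = N v w' by have := e (inl v); rewrite inE eqxx; exact.
by have -> : C v w = C v w' by have := e (inr v); rewrite !inE eqxx orbT; exact.
Qed.

Lemma depends_on_comp {A B : Type} K (f : Omega -> A) (g : A -> B) :
  depends_on Y K f -> depends_on Y K (g \o f).
Proof. by move=> fK w w' /fK /= ->. Qed.

Lemma depends_onM K L (f g : Omega -> R) : depends_on Y K f -> depends_on Y L g ->
  depends_on Y (K ++ L) (fun w => f w * g w).
Proof.
move=> fK gL w w' e; rewrite (fK w w') ?(gL w w')//.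
  by move=> i iL; apply: e; rewrite mem_cat iL orbT.
by move=> i iK; apply: e; rewrite mem_cat iK.
Qed.

Lemma depends_onD K L (f g : Omega -> R) : depends_on Y K f -> depends_on Y L g ->
  depends_on Y (K ++ L) (fun w => f w + g w).
Proof.
move=> fK gL w w' e; rewrite (fK w w') ?(gL w w')//.
  by move=> i iL; apply: e; rewrite mem_cat iL orbT.
by move=> i iK; apply: e; rewrite mem_cat iK.
Qed.

Lemma exprn_itv (s : R) n : 0 <= s <= 1 -> 0 <= s ^+ n <= 1.
Proof. by case/andP=> s0 s1; rewrite exprn_ge0//= exprn_ile1. Qed.

Lemma mulr_itv (x y : R) : 0 <= x <= 1 -> 0 <= y <= 1 -> 0 <= x * y <= 1.
Proof. by move=> /andP[x0 x1] /andP[y0 y1]; rewrite mulr_ge0//= mulr_ile1. Qed.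

Lemma bool_itv (b : bool) : (0 : R) <= (b%:R : R) <= 1.
Proof. by case: b; rewrite ?lexx ?ler01. Qed.

(** Conditioning on [N v], independent of the cars at [v] and of the two disjoint subtrees. The
    means at the two children stay separate, as their equality is only derived afterwards. *)
Lemma mean_tree_var z0 c t n v (s : R) : 0 <= s <= 1 ->
  let h i := mean P (fun w => s ^+ t (tree_var z0 c t n (i :: v) w)) in
  mean P (fun w => s ^+ tree_var z0 c t n.+1 v w) =
  mean P (fun w => s ^+ c (C v w)) * (4^-1 + h 0%N / 2 + h 0%N * h 1%N / 4).
Proof.
move=> s01 h.
pose B i w := s ^+ t (tree_var z0 c t n (i :: v) w).
have B01 i w : 0 <= B i w <= 1 by exact: exprn_itv.
have dB i : depends_on Y (tree_idx n (i :: v)) (B i).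
  apply: (depends_on_comp _ _ (fun k => s ^+ t k)).
  exact: depends_tree_var.
have dN (g : nat -> R) : depends_on Y [:: inl v] (fun w => g (N v w)).
  by move=> w w' e; have := e (inl v); rewrite inE eqxx /= => ->.
pose I0 w : R := (N v w == 0%N)%:R.
pose I1 w : R := (N v w == 1%N)%:R.
(* The event is [1 < N v] rather than [N v = 2], as in [tree_rec], so that the decomposition holds
   for every outcome. *)
pose I2 w : R := (1 < N v w)%N%:R.
have mes K (f : Omega -> R) : depends_on Y K f -> (forall w, 0 <= f w <= 1) ->
    measurable_fun setT f.
  by move=> fK f01; apply: (measurable_depends Y K) => // w; case/andP: (f01 w).
have dI0 : depends_on Y [:: inl v] I0 := dN (fun k => (k == 0%N)%:R).
have dI1 : depends_on Y [:: inl v] I1 := dN (fun k => (k == 1%N)%:R).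
have dI2 : depends_on Y [:: inl v] I2 := dN (fun k => (1 < k)%N%:R).
have dBB := depends_onM _ _ _ _ (dB 0%N) (dB 1%N).
have dIB := depends_onM _ _ _ _ dI1 (dB 0%N).
have dIBB := depends_onM _ _ _ _ dI2 dBB.
have BB01 w : 0 <= B 0%N w * B 1%N w <= 1 by exact: mulr_itv.
have IB01 w : 0 <= I1 w * B 0%N w <= 1 by apply: mulr_itv => //; exact: bool_itv.
have IBB01 w : 0 <= I2 w * (B 0%N w * B 1%N w) <= 1.
  by apply: mulr_itv => //; exact: bool_itv.
have dS := depends_onD _ _ _ _ (depends_onD _ _ _ _ dI0 dIB) dIBB.
have S01 w : 0 <= I0 w + I1 w * B 0%N w <= 1.
  have := B01 0%N w; rewrite /I0 /I1; case: (N v w) => [|[|k]] /=;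
  rewrite ?mul0r ?mul1r ?addr0 ?add0r ?lexx ?ler01//.
have SS01 w : 0 <= I0 w + I1 w * B 0%N w + I2 w * (B 0%N w * B 1%N w) <= 1.
  have := BB01 w; have := S01 w; rewrite /I0 /I1 /I2; case: (N v w) => [|[|k]] /=;
  rewrite ?mul0r ?mul1r ?addr0 ?add0r ?lexx ?ler01//.
have -> : mean P (fun w => s ^+ tree_var z0 c t n.+1 v w) =
    mean P (fun w => s ^+ c (C v w) *
      (I0 w + I1 w * B 0%N w + I2 w * (B 0%N w * B 1%N w))).
  apply: eq_mean => w; rewrite /tree_var /= !exprD -mulrA; congr (_ * _).
  rewrite /I0 /I1 /I2 /B /tree_var; case: (N v w) => [|[|k]] /=;
  by rewrite ?mul0n ?mul1n ?expr0 ?mul0r ?mul1r ?mulr1 ?addr0 ?add0r.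
rewrite (mean_indep Y indY [:: inr v] _ _ _ _ _ dS) //; last 3 first.
- rewrite !has_cat /=.
  have nK i : has (mem [:: inr v]) (tree_idx n (i :: v)) = false.
    apply/hasP => -[j jK]; rewrite /= inE => /eqP jv.
    by move: jK; rewrite notin_tree_idx// jv.
  by rewrite !nK.
- by move=> w w' e; have := e (inr v); rewrite inE eqxx /= => ->.
- by move=> w; exact: exprn_itv.
congr (_ * _).
rewrite meanD//; first last.
- exact: (mes _ _ dIBB).
- exact: (mes _ _ (depends_onD _ _ _ _ dI0 dIB)).
rewrite meanD//; first last.
- by move=> w; exact: bool_itv.
- exact: (mes _ _ dIB).
- by apply: (mes _ _ dI0) => w; exact: bool_itv.
have nK i : has (mem [:: inl v]) (tree_idx n (i :: v)) = false.
  apply/hasP => -[j jK]; rewrite /= inE => /eqP jv.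
  by move: jK; rewrite notin_tree_idx// jv.
rewrite (mean_indep Y indY _ _ _ _ _ dI1 (dB 0%N)) ?nK//; last first.
  by move=> w; exact: bool_itv.
rewrite (mean_indep Y indY _ _ _ _ _ dI2 dBB) ?has_cat ?nK//; last first.
  by move=> w; exact: bool_itv.
rewrite (mean_indep Y indY _ _ _ _ _ (dB 0%N) (dB 1%N)) ?disjoint_tree_idx//.
rewrite (mean_offspring v (fun k => (k == 0%N)%:R)) ?(mean_offspring v (fun k => (k ==
  1%N)%:R)).
rewrite (mean_offspring v (fun k => (1 < k)%N%:R)).
- by rewrite /= /h /B; field.
- by move=> k; exact: bool_itv.
- by move=> k; exact: bool_itv.
- by move=> k; exact: bool_itv.
Qed.

End tree_recursion.

(** * The recursive distributional equation *)

Lemma eq0_of_le_harmonic {R : realType} (x k : R) :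
  (forall n : nat, `|x| <= k / n.+1%:R) -> x = 0.
Proof.
move=> xk; apply/eqP/contraT => x0.
have x_gt0 : 0 < `|x| by rewrite normr_gt0.
have := truncnS_gt (k / `|x|); rewrite ltr_pdivrMr// ltNge => /negP; case.
by rewrite mulrC -ler_pdivlMr ?ltr0Sn.
Qed.

(** * Generating functions of natural-number variables *)

Section pgf.
Context {d : measure_display} {Omega : measurableType d} {R : realType}
  {P : probability Omega R}.
Variable T : Omega -> nat.
Hypothesis mT : forall n, measurable [set w | T w = n].

Definition pgf (s : R) : R := mean P (fun w => s ^+ T w).

Lemma measurable_comp_nat (g : nat -> R) : measurable_fun setT (fun w => g (T w)).
Proof. exact: measurable_natfun. Qed.

Lemma pgf_itv s : 0 <= s <= 1 -> 0 <= pgf s <= 1.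
Proof.
move=> s01; apply: mean_itv => [|w]; last exact: exprn_itv.
exact: (measurable_comp_nat (fun k => s ^+ k)).
Qed.

Lemma integral_pgf s : 0 <= s <= 1 -> (\int[P]_w (s ^+ T w)%:E)%E = (pgf s)%:E.
Proof.
move=> s01; apply: integral_mean => [|w]; last exact: exprn_itv.
exact: (measurable_comp_nat (fun k => s ^+ k)).
Qed.

(** The bound holds term by term with a constant independent of the exponent; it yields continuity
    below 1. *)
Lemma pgf_lip (t s : R) : 0 <= t -> t <= s -> s < 1 ->
  pgf t <= pgf s <= pgf t + (s - t) / (1 - s).
Proof.
move=> t0 ts s1.
have s0 := le_trans t0 ts.
have t01 : 0 <= t <= 1 by rewrite t0 (le_trans ts)// ltW.
have s01 : 0 <= s <= 1 by rewrite s0 ltW.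
have mts := measurable_comp_nat.
apply/andP; split.
  apply: ler_mean.
  - exact: (mts (fun k => t ^+ k)).
  - exact: (mts (fun k => s ^+ k)).
  - by move=> w; exact: exprn_itv.
  - by move=> w; exact: exprn_itv.
  - by apply: aeW => w; exact: lerXn2r.
(* The factor [1 - s] is kept on the left, so that all the functions averaged below stay within
   [0, 1]. *)
have key n : (1 - s) * s ^+ n <= (1 - s) * t ^+ n + (s - t).
  elim: n => [|n IHn]; first by rewrite !expr0; lra.
  have tn1 : t ^+ n <= 1 by case/andP: (exprn_itv _ n t01).
  have := ler_wpM2l s0 IHn.
  have : (s - t) * (1 - s) * t ^+ n <= (s - t) * (1 - s) * 1.
    by rewrite ler_wpM2l// mulr_ge0// subr_ge0// ltW.
  by rewrite !exprS; lra.
have c01 n r : 0 <= r <= 1 -> 0 <= (1 - s) * r ^+ n <= 1.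
  by move=> /(exprn_itv _ n) r01; apply: mulr_itv => //; lra.
have st01 : 0 <= s - t <= 1 by lra.
have sum01 n : 0 <= (1 - s) * t ^+ n + (s - t) <= 1.
  case/andP: (exprn_itv _ n t01) => tn0 tn1; rewrite addr_ge0 ?subr_ge0//=; last first.
    by rewrite mulr_ge0// subr_ge0 ltW.
  have : (1 - s) * t ^+ n <= (1 - s) * 1 by rewrite ler_wpM2l// subr_ge0 ltW.
  by lra.
have : (1 - s) * pgf s <= (1 - s) * pgf t + (s - t).
  have mZ r : 0 <= r <= 1 -> (1 - s) * pgf r = mean P (fun w => (1 - s) * r ^+ T w).
    move=> r01; rewrite meanZ//; last lra.
    by move=> w; exact: exprn_itv.
  rewrite !mZ//.
  rewrite -[X in _ <= _ + X](mean_cst (P := P)) -meanD//.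
  - apply: ler_mean => //.
    + exact: (mts (fun k => (1 - s) * s ^+ k)).
    + exact: (mts (fun k => (1 - s) * t ^+ k + (s - t))).
    + by move=> w; exact: c01.
    + by apply: aeW.
  - exact: (mts (fun k => (1 - s) * t ^+ k)).
  - by move=> w; exact: c01.
by move=> le; rewrite -lerBlDl ler_pdivlMr ?subr_gt0//; lra.
Qed.

(** Since [0 ^+ n] is the indicator of [n = 0], the difference [s ^+ n - 0 ^+ n] is 0 for [n = 0]
    and lies between 0 and [s] otherwise. *)
Lemma pgf_near0 (s : R) : 0 <= s <= 1 -> pgf 0 <= pgf s <= pgf 0 + s.
Proof.
move=> s01; have mts := measurable_comp_nat.
have z01 : 0 <= (0 : R) <= 1 by rewrite lexx ler01.
apply/andP; split.
  apply: ler_mean.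
  - exact: (mts (fun k => 0 ^+ k)).
  - exact: (mts (fun k => s ^+ k)).
  - by move=> w; exact: exprn_itv.
  - by move=> w; exact: exprn_itv.
  - by apply: aeW => w; rewrite lerXn2r ?nnegrE//; case/andP: s01.
have e01 n : 0 <= (1 - 0 ^+ n) * s <= 1.
  by apply: mulr_itv => //; have := exprn_itv 0 n z01; lra.
have -> : pgf s = mean P (fun w => 0 ^+ T w + (s ^+ T w - 0 ^+ T w)).
  by apply: eq_mean => w; rewrite addrC subrK.
have d01 n : 0 <= s ^+ n - 0 ^+ n <= 1.
  have := exprn_itv _ n s01; rewrite expr0n; case: n => [|n] /=.
    by rewrite expr0; lra.
  by rewrite subr0.
rewrite meanD//.
- rewrite lerD2l -[leRHS](mean_cst (P := P)); apply: ler_mean => //.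
  + exact: (mts (fun k => s ^+ k - 0 ^+ k)).
  + apply: aeW => w; case: (T w) => [|k]; first by rewrite !expr0; lra.
    by rewrite expr0n subr0 exprS ler_piMr//; [lra|case/andP: (exprn_itv _ k s01)].
- exact: (mts (fun k => s ^+ k - 0 ^+ k)).
- by move=> w; exact: exprn_itv.
Qed.

(** Termwise, [s * s ^+ n.-1 = s ^+ n - (1 - s) * 0 ^+ n]. The truncation of the predecessor at 0 is
    what brings the probability of 0 into the equation. *)
Lemma mean_pred (s : R) : 0 <= s <= 1 ->
  s * mean P (fun w => s ^+ (T w).-1) = pgf s - (1 - s) * pgf 0.
Proof.
move=> s01; have mts := measurable_comp_nat.
have z01 : 0 <= (0 : R) <= 1 by rewrite lexx ler01.
have s01' : 0 <= 1 - s <= 1 by lra.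
have mZ r (g : nat -> R) : 0 <= r -> (forall n, 0 <= g n <= 1) ->
    r * mean P (fun w => g (T w)) = mean P (fun w => r * g (T w)).
  by move=> r0 g01; rewrite meanZ.
rewrite /pgf (mZ _ (fun k => s ^+ k.-1)); [|lra|by move=> n; exact: exprn_itv].
rewrite (mZ _ (fun k => 0 ^+ k)); [|lra|by move=> n; exact: exprn_itv].
apply/eqP; rewrite eq_sym subr_eq -meanD; first last.
- by move=> w; apply: mulr_itv => //; exact: exprn_itv.
- by move=> w; apply: mulr_itv => //; exact: exprn_itv.
- exact: (mts (fun k => (1 - s) * 0 ^+ k)).
- exact: (mts (fun k => s * s ^+ k.-1)).
apply/eqP/eq_mean => w; case: (T w) => [|k]; first by rewrite !expr0; lra.
by rewrite /= [in X in _ + X]expr0n mulr0 addr0 exprS.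
Qed.

End pgf.
Arguments pgf {d Omega R} P T s.

(** * From truncated trees to the law of [X] *)

Section parking_law.
Context {d : measure_display} {Omega : measurableType d} {R : realType}
  {P : probability Omega R} {alpha : R}.
Variables N C : vertex -> {RV P >-> nat}.
Hypothesis alpha_ge0 : 0 <= alpha.
Hypothesis NC : bgw_parking alpha N C.

Local Notation gen n v := (tree_var N C 1 (fun=> 0%N) id n v).
Local Notation vis n v := (tree_var N C 0 id predn n v).

Lemma measurable_tree_var z0 c t n v k :
  measurable [set w | tree_var N C z0 c t n v w = k].
Proof.
pose f w : R := (tree_var N C z0 c t n v w == k)%:R.
have mf : measurable_fun setT f.
  apply: (measurable_depends _ (tree_idx n v)) => [|w]; last first.
    by case/andP: (bool_itv (R := R) (tree_var N C z0 c t n v w == k)).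
  apply: (depends_on_comp _ _ _ _ (fun m => (m == k)%:R)).
  exact: (depends_tree_var (P := P)).
rewrite (_ : [set w | _] = f @^-1` [set 1]); last first.
  apply/seteqP; split => w; rewrite /f /=; first by move=> ->; rewrite eqxx.
  by case: eqP => // _ /esym/eqP; rewrite oner_eq0.
rewrite -[_ @^-1` _]setTI; exact: mf.
Qed.

(* If [q] is the probability to reach generation [n], the next one is
   [q - q ^+ 2 / 4]; the bound [4 / (n + 4)] is a supersolution. *)
Lemma pgf_generation n v : 1 - 4 / (n + 4)%:R <= pgf P (gen n v) 0.
Proof.
elim: n v => [|n IHn] v.
  have /andP[+ _] := pgf_itv (P := P) _ (measurable_tree_var 1 (fun=> 0%N) id 0 v) 0
    ltac:(by rewrite lexx ler01).
  by apply: le_trans; rewrite add0n divff// subrr.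
have z01 : 0 <= (0 : R) <= 1 by rewrite lexx ler01.
rewrite /pgf (mean_tree_var N C NC)// expr0 mean_cst mul1r.
have := IHn (0%N :: v); have := IHn (1%N :: v); rewrite /pgf /=.
set h0 := mean _ _; set h1 := mean _ _ => h0P h1P.
have n4 : 0 < (n + 4)%:R :> R by rewrite ltr0n addn_gt0 orbT.
have n5 : 0 < (n.+1 + 4)%:R :> R by rewrite ltr0n.
set q := 4 / (n + 4)%:R in h0P h1P.
have q01 : 0 <= q <= 1.
  by rewrite /q divr_ge0 ?(ltW n4)//= ler_pdivrMr// mul1r ler_nat leq_addl.
have : (1 - q) * (1 - q) <= h1 * h0 by rewrite ler_pM//; lra.
have : 1 - 4 / (n.+1 + 4)%:R <= 1 - q + q ^+ 2 / 4.
  rewrite /q addSn -addn1 natrD; set m : R := (n + 4)%:R.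
  rewrite -/m in n4.
  rewrite -subr_ge0 (_ : _ - _ = 4 / (m ^+ 2 * (m + 1))); last by field; lra.
  by rewrite divr_ge0// mulr_ge0 ?exprn_ge0//; lra.
set l := 1 - _ => lP pP; lra.
Qed.


(* The generating function on ]0, 1] determines its value at 0, hence that of
   [(V - 1)^+]. *)
Lemma mean_pred_pgf n v v' (s : R) :
  (forall r : R, 0 < r <= 1 -> pgf P (vis n v) r = pgf P (vis n v') r) -> 0 < s <= 1 ->
  mean P (fun w => s ^+ predn (vis n v w)) = mean P (fun w => s ^+ predn (vis n v' w)).
Proof.
move=> eqG s01; have s01' : 0 <= s <= 1 by lra.
have p0 : pgf P (vis n v) 0 = pgf P (vis n v') 0.
  (* Both values at 0 lie within [x = 1 / (m + 1)] of the common value at [x]. *)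
  apply/eqP; rewrite -subr_eq0; apply/eqP/(eq0_of_le_harmonic _ 1) => m.
  have m0 : 0 < (1 / m.+1%:R : R) <= 1.
    by rewrite divr_gt0//= ler_pdivrMr// mul1r ler1n.
  move: (1 / _) m0 => x x01; have x01' : 0 <= x <= 1 by lra.
  have := pgf_near0 (P := P) _ (measurable_tree_var 0 id predn n v) _ x01'.
  have := pgf_near0 (P := P) _ (measurable_tree_var 0 id predn n v') _ x01'.
  by rewrite (eqG _ x01) ler_norml; lra.
have s_neq0 : s != 0 by rewrite gt_eqF//; lra.
apply: (mulfI s_neq0).
rewrite !(mean_pred (P := P) _ (measurable_tree_var 0 id predn n _) _ s01').
by rewrite p0 eqG.
Qed.

(** All subtrees have the same law: by induction on [n], the recursion involves [v] only through its
    children. *)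
Lemma pgf_visits_vertex n v v' (s : R) : 0 < s <= 1 ->
  pgf P (vis n v) s = pgf P (vis n v') s.
Proof.
elim: n v v' s => [|n IHn] v v' s s01; first by [].
have s01' : 0 <= s <= 1 by lra.
have h u u' := mean_pred_pgf n u u' s (IHn u u') s01.
rewrite /pgf !(mean_tree_var N C NC)// (h _ [::]) (h (1%N :: v) [::]).
rewrite (h (0%N :: v') [::]) (h (1%N :: v') [::]).
by rewrite !(mean_cars N C alpha_ge0 NC).
Qed.

(** The offspring generating function [1 / 4 + h / 2 + h ^+ 2 / 4] is the square of
    [(1 + h) / 2]. *)
Lemma pgf_visits_succ n (s : R) : 0 < s <= 1 ->
  pgf P (vis n.+1 [::]) s = expR (alpha * (s - 1)) *
    ((1 + mean P (fun w => s ^+ predn (vis n [::] w))) / 2) ^+ 2.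
Proof.
move=> s01; have s01' : 0 <= s <= 1 by lra.
have h u := mean_pred_pgf n u [::] s (fun r r01 => pgf_visits_vertex n u [::] r r01) s01.
rewrite /pgf (mean_tree_var N C NC)// (h [:: 0%N]) (h [:: 1%N]).
by rewrite (mean_cars N C alpha_ge0 NC)//; congr (_ * _); field.
Qed.

Variable X : {RV P >-> nat}.
Hypothesis XE : counts_root_visits N C X.

Lemma root_visits_approx n w : (forall u, N u w <= 2)%N ->
  gen n [::] w = 0%N -> X w = vis n [::] w.
Proof.
move=> N2 g0; have fin := finite_subtree _ (fun u => C u w) N2 _ _ g0.
have [|s arr ->] := XE w.
  by apply: sub_finite_set fin => u /= ->; rewrite suffix0s.
by rewrite root_visitsE; apply: truncated_visitsE arr _ g0.
Qed.

(** Vertices are countable, so the exceptional null events are united along their enumeration. *)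
Lemma offspring_le2_all : {ae P, forall w, forall u, (N u w <= 2)%N}.
Proof.
have : {ae P, forall w, forall k, if unpickle k is Some u then (N u w <= 2)%N else true}.
  apply/ae_foralln => k; case: unpickle => [u|]; last exact: aeW.
  exact: (offspring_le2 _ _ NC).
apply: filterS => w Nw u; have := Nw (pickle u).
by rewrite pickleK.
Qed.

(** Up to a null event, [X] differs from its truncation only when generation [n] is non-empty. *)
Lemma mean_visits_approx n (f : nat -> R) : (forall k, 0 <= f k <= 1) ->
  `|mean P (fun w => f (X w)) - mean P (fun w => f (vis n [::] w))| <= 4 / (n + 4)%:R.
Proof.
(* [D] is the indicator that generation [n] is empty. *)
move=> f01; pose D w : R := 0 ^+ gen n [::] w.
have z01 : 0 <= (0 : R) <= 1 by rewrite lexx ler01.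
have D01 w : 0 <= D w <= 1 by exact: exprn_itv.
have mD : measurable_fun setT D.
  exact: (measurable_comp_nat _ (measurable_tree_var _ _ _ _ _) (fun k => 0 ^+ k)).
have mX : measurable_fun setT (fun w => f (X w)).
  exact: (measurable_natfun _ (measurable_RVnat X) f).
have mV : measurable_fun setT (fun w => f (vis n [::] w)).
  exact: (measurable_natfun _ (measurable_tree_var _ _ _ _ _) f).
have mD1 : mean P (fun w => 1 - D w) <= 4 / (n + 4)%:R.
  have := pgf_generation n [::]; rewrite /pgf -/D.
  have : mean P (fun w => D w + (1 - D w)) = 1.
    by rewrite -[RHS](mean_cst (P := P)); apply: eq_mean => w; rewrite addrC subrK.
  rewrite meanD//.
    lra.
  - exact: measurable_funB.
  - by move=> w; have := D01 w; lra.
(* Almost surely [T] is at most [S * D + (1 - D)]; the absolute value then follows by exchanging [T]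
   and [S]. *)
have half (T S : Omega -> R) : measurable_fun setT T -> measurable_fun setT S ->
    (forall w, 0 <= T w <= 1) -> (forall w, 0 <= S w <= 1) ->
    (forall w, (forall u, N u w <= 2)%N -> gen n [::] w = 0%N -> T w = S w) ->
    mean P T <= mean P S + 4 / (n + 4)%:R.
  move=> mT mS T01 S01 TS.
  apply: (@le_trans _ _ (mean P (fun w => S w * D w + (1 - D w)))).
    apply: ler_mean => //.
    - by apply: measurable_funD; [exact: measurable_funM|exact: measurable_funB].
    - move=> w; rewrite /D expr0n; case: eqP => _ /=; have := S01 w; lra.
    - apply: filterS offspring_le2_all => w N2.
      rewrite /D expr0n; case: eqP => [g0|_] /=.
        by rewrite mulr1 subrr addr0 (TS w).
      by rewrite mulr0 add0r subr0; case/andP: (T01 w).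
  rewrite meanD//; first last.
  - by move=> w; have := D01 w; lra.
  - by move=> w; exact: mulr_itv.
  - exact: measurable_funB.
  - exact: measurable_funM.
  rewrite lerD// ler_mean//.
  - exact: measurable_funM.
  - by move=> w; exact: mulr_itv.
  - by apply: aeW => w; rewrite ler_piMr//; [case/andP: (S01 w)|case/andP: (D01 w)].
have XV w : (forall u, N u w <= 2)%N -> gen n [::] w = 0%N -> f (X w) = f (vis n [::] w).
  by move=> N2 /(root_visits_approx _ _ N2) ->.
have := half _ _ mX mV (fun w => f01 _) (fun w => f01 _) XV.
have := half _ _ mV mX (fun w => f01 _) (fun w => f01 _) (fun w N2 g0 => esym (XV w N2
  g0)).
by rewrite ler_norml; move: (4 / _) => e; lra.
Qed.

(** The limit of [pgf_visits_succ], taken with explicit error bounds. *)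
Lemma pgf_recursive_equation (s : R) : 0 < s <= 1 ->
  pgf P X s = expR (alpha * (s - 1)) *
    ((1 + mean P (fun w => s ^+ predn (X w))) / 2) ^+ 2.
Proof.
move=> s01; have s01' : 0 <= s <= 1 by lra.
(* The truncations at depths [n] and [n + 1] each cost at most [4 / (n + 1)]. *)
apply/eqP; rewrite -subr_eq0; apply/eqP/(eq0_of_le_harmonic _ 8) => n.
have := mean_visits_approx n.+1 (fun k => s ^+ k) (fun k => exprn_itv _ k s01').
have := mean_visits_approx n (fun k => s ^+ k.-1) (fun k => exprn_itv _ k.-1 s01').
rewrite -/(pgf P X s) -/(pgf P (vis n.+1 [::]) s) pgf_visits_succ//.
set H := mean _ _; set Hn := mean _ _; set G := pgf _ _ _; set e := expR _.
have /andP[H0 H1] : 0 <= H <= 1.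
  apply: mean_itv => [|w]; last exact: exprn_itv.
  exact: (measurable_natfun _ (measurable_RVnat X) (fun k => s ^+ k.-1)).
have /andP[Hn0 Hn1] : 0 <= Hn <= 1.
  apply: mean_itv => [|w]; last exact: exprn_itv.
  exact: (measurable_natfun _ (measurable_tree_var _ _ _ _ _) (fun k => s ^+ k.-1)).
have e0 : 0 <= e by exact: expR_ge0.
have e1 : e <= 1 by rewrite -expR0 ler_expR mulr_ge0_le0//; lra.
have n1 : 0 < n.+1%:R :> R by [].
have le4 k : (n.+1 <= k)%N -> 4 / k%:R <= 4 / n.+1%:R :> R.
  move=> nk; rewrite ler_pM2l// lef_pV2 ?posrE ?ler_nat// ltr0n.
  exact: leq_trans nk.
have := le4 (n + 4)%N; rewrite -[in X in (X <= _)%N]addn1 leq_add2l => /(_ isT).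
have := le4 (n.+1 + 4)%N (leq_addr _ _).
have -> : 8 / n.+1%:R = 2 * (4 / n.+1%:R) :> R by rewrite mulrA -natrM.
move: (4 / n.+1%:R) (4 / (n + 4)%:R) (4 / (n.+1 + 4)%:R) => x y z b1 b2 a1 a2.
(* The difference of the two squares is factored; its coefficient in front of [Hn - H] lies in
   [0, 1]. *)
have -> : G - e * ((1 + H) / 2) ^+ 2 = (G - e * ((1 + Hn) / 2) ^+ 2) +
  e * ((2 + H + Hn) / 4) * (Hn - H) by field.
rewrite (le_trans (ler_normD _ _))// normrM [`|_ * _|]ger0_norm; last first.
  by rewrite mulr_ge0//; lra.
have c1 : e * ((2 + H + Hn) / 4) <= 1 by rewrite mulr_ile1//; lra.
have : e * ((2 + H + Hn) / 4) * `|Hn - H| <= `|Hn - H| by rewrite ler_piMl.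
move: a1; rewrite distrC => a1 a3.
lra.
Qed.

Lemma pgf_quadratic (s : R) : 0 < s <= 1 ->
  4 * s ^+ 2 * pgf P X s = expR (alpha * (s - 1)) *
    (pgf P X s - pgf P X 0 + s * (1 + pgf P X 0)) ^+ 2.
Proof.
move=> s01; have s01' : 0 <= s <= 1 by lra.
have HE : s * mean P (fun w => s ^+ predn (X w)) = _ :=
  mean_pred (P := P) _ (measurable_RVnat X) _ s01'.
have -> : pgf P X s - pgf P X 0 + s * (1 + pgf P X 0) =
    s * (1 + mean P (fun w => s ^+ predn (X w))).
  by rewrite [RHS]mulrDr HE; ring.
by rewrite {1}pgf_recursive_equation//; field.
Qed.
End parking_law.

(** * Analysis of the generating function *)

Section calculus.
Context {R : realType}.
Implicit Types (f g k : R -> R) (a b s t : R).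

Lemma is_deriveM1 f g s (df dg : R) : is_derive s 1 f df -> is_derive s 1 g dg ->
  is_derive s 1 (fun x => f x * g x) (f s * dg + g s * df).
Proof. by move=> fd gd; apply: is_derive_eq. Qed.

Lemma is_deriveB1 f g s (df dg : R) : is_derive s 1 f df -> is_derive s 1 g dg ->
  is_derive s 1 (fun x => f x - g x) (df - dg).
Proof. by move=> fd gd; apply: is_derive_eq. Qed.

Lemma is_derive_affine a b s : is_derive s 1 (fun x => x * a + b) a.
Proof.
have -> : (fun x => x * a + b) = (a \*: id) + cst b.
  by apply/funext => x /=; rewrite mulrC.
by apply: is_derive_eq; rewrite addr0 /GRing.scale /= mulr1.
Qed.

Lemma is_derive_expR_affine a b s :
  is_derive s 1 (fun x => expR (a * (x - b))) (a * expR (a * (s - b))).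
Proof.
have -> : (fun x => expR (a * (x - b))) = expR \o (fun x => x * a + (- b * a)).
  by apply/funext => x /=; rewrite -mulrDl mulrC.
have d := is_derive_affine a (- b * a) s.
by apply: is_derive_eq; rewrite -mulrDl ![_ * a]mulrC.
Qed.

Lemma is_derive_within_continuous f (df : R -> R) a b :
  (forall x, a <= x <= b -> is_derive x 1 f (df x)) ->
  {within `[a, b], continuous f}.
Proof.
move=> fd; apply: derivable_within_continuous => x; rewrite in_itv /= => xab.
by have := fd x xab; case.
Qed.

(** The difference quotient is positive near [a]. This turns slopes at 1 into signs just before
    1. *)
Lemma derive_pos_lt0_left k a (dk : R) : k a = 0 -> is_derive a 1 k dk -> 0 < dk ->
  exists2 b, b < a & forall s, b < s < a -> k s < 0.
Proof.
move=> ka [kd <-] dk0.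
have := kd; rewrite /derivable => /cvg_ex[l kl].
have el : 'D_1 k a = l by apply/cvg_lim.
rewrite el in dk0.
have /nbhs_ballP[e /= e0 ne] : \forall h \near (0 : R)^',
  0 < h^-1 *: (k (h *: 1 + a) - k a).
  exact: (cvgr_gt _ kl _ dk0).
exists (a - e); first lra.
move=> s /andP[es sa].
have := ne (s - a); rewrite /ball /= sub0r normrN ltr0_norm; last lra.
move=> /(_ ltac:(lra)); rewrite subr_eq0 lt_eqF// => /(_ isT).
rewrite /GRing.scale /= mulr1 subrK ka subr0.
by rewrite nmulr_rgt0// invr_lt0 subr_lt0.
Qed.

End calculus.

(** * Sign and zeros of the square root in the quadratic equation *)

Section pgf_analysis.
Context {R : realType}.
Variables (alpha : R) (G : R -> R).
Hypothesis alpha_ge0 : 0 <= alpha.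
Implicit Types q s t a m : R.

Local Notation p := (G 0).

(** The parameter [q] stands for [p] or for [1 - alpha]; the latter gives the radicand of the
    subcritical formula. *)
Definition pgf_radicand (q s : R) : R :=
  s ^+ 2 - expR (alpha * (s - 1)) * (s * (1 + q) - q).

(* [rad_ratio q s < 1] iff [0 < pgf_radicand q s]; the numerator of its
   derivative is the quadratic [crit_poly q]. *)
Definition rad_ratio (q s : R) : R :=
  (s * (1 + q) - q) * expR (alpha * (s - 1)) * (s^-1 * s^-1).

Definition crit_poly (q s : R) : R :=
  alpha * (1 + q) * s ^+ 2 - (1 + (1 + alpha) * q) * s + 2 * q.

Lemma pgf_radicandE q s : s != 0 -> pgf_radicand q s = s ^+ 2 * (1 - rad_ratio q s).
Proof. by move=> s0; rewrite /pgf_radicand /rad_ratio; field. Qed.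

Lemma rad_ratio1 q : rad_ratio q 1 = 1.
Proof. by rewrite /rad_ratio subrr mulr0 expR0 invr1; ring. Qed.

Lemma pgf_radicand1 q : pgf_radicand q 1 = 0.
Proof. by rewrite /pgf_radicand subrr mulr0 expR0; ring. Qed.

Lemma is_derive_rad_ratio q s : s != 0 ->
  is_derive s 1 (rad_ratio q) (expR (alpha * (s - 1)) * crit_poly q s / s ^+ 3).
Proof.
move=> s0.
have dV : is_derive s 1 (fun x : R => x^-1) (- s ^- 2).
  by apply: (is_derive_eq (is_deriveV s0 (is_derive_id s 1)));
    rewrite /GRing.scale /= mulr1.
have := is_deriveM1 _ _ _ _ _ (is_deriveM1 _ _ _ _ _ (is_derive_affine (1 + q) (- q) s)
  (is_derive_expR_affine alpha 1 s)) (is_deriveM1 _ _ _ _ _ dV dV).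
move=> d; apply: (is_derive_eq d).
by rewrite /crit_poly /=; field.
Qed.

Lemma is_derive_radicand1 q : is_derive (1 : R) 1 (pgf_radicand q) (1 - alpha - q).
Proof.
have := is_deriveB1 _ _ _ _ _ (is_deriveM1 _ _ _ _ _ (is_derive_affine 1 0 1)
  (is_derive_affine 1 0 1))
 (is_deriveM1 _ _ _ _ _ (is_derive_expR_affine alpha 1 1) (is_derive_affine (1 + q) (-
   q) 1)).
set F := (fun x => _) => d.
have -> : pgf_radicand q = F.
  by apply/funext => x; rewrite /pgf_radicand /F !mulr1 !addr0 expr2.
by apply: (is_derive_eq d); rewrite subrr mulr0 expR0; ring.
Qed.

(** By the mean value theorem, the ratio decreases strictly to its value 1 at 1. *)
Lemma rad_ratio_gt1 q a : 0 < a < 1 -> (forall s, a < s < 1 -> crit_poly q s < 0) ->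
  1 < rad_ratio q a.
Proof.
move=> /andP[a0 a1] Q0.
have [||c] := @MVT _ (rad_ratio q)
    (fun s => expR (alpha * (s - 1)) * crit_poly q s / s ^+ 3) _ _ a1.
- move=> x; rewrite in_itv /= => /andP[ax _].
  by apply: is_derive_rad_ratio; rewrite gt_eqF//; lra.
- apply: (is_derive_within_continuous (rad_ratio q)
    (fun s => expR (alpha * (s - 1)) * crit_poly q s / s ^+ 3) a 1) => x /andP[ax _].
  by apply: is_derive_rad_ratio; rewrite gt_eqF//; lra.
rewrite in_itv /= => c1 E; rewrite -subr_lt0 -[X in X - _](rad_ratio1 q) E.
have c3 : 0 < (c ^+ 3)^-1 by rewrite invr_gt0 exprn_gt0//; lra.
by rewrite pmulr_llt0 ?subr_gt0// pmulr_llt0// pmulr_rlt0 ?expR_gt0// Q0.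
Qed.

(* Fermat at an interior zero of the nonnegative radicand, and Rolle between it
   and the zero at 1. *)
Lemma crit_poly_roots q s0 : (forall s, 0 < s <= 1 -> 0 <= pgf_radicand q s) ->
  0 < s0 < 1 -> pgf_radicand q s0 = 0 ->
  crit_poly q s0 = 0 /\ exists2 s1, s0 < s1 < 1 & crit_poly q s1 = 0.
Proof.
move=> rad0 /andP[s00 s01] r0.
have d s : 0 < s -> is_derive s 1 (rad_ratio q)
    (expR (alpha * (s - 1)) * crit_poly q s / s ^+ 3).
  by move=> s_gt0; apply: is_derive_rad_ratio; rewrite gt_eqF.
have dv s : 0 < s -> derivable (rad_ratio q) s 1 by move=> /d [].
have ratio0 : rad_ratio q s0 = 1.
  have := r0; rewrite pgf_radicandE ?gt_eqF// => /eqP.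
  rewrite mulf_eq0 expf_eq0 /= gt_eqF//= subr_eq0 => /eqP ->//.
have crit0 s : 0 < s -> is_derive s 1 (rad_ratio q) 0 -> crit_poly q s = 0.
  move=> s_gt0 [_ e0]; have [_] := d _ s_gt0; rewrite e0 => /esym/eqP.
  rewrite !mulf_eq0 invr_eq0 expf_eq0 /= [s == 0]gt_eqF// orbF.
  by rewrite gt_eqF ?expR_gt0//= => /eqP.
split.
  apply: (crit0 s0 s00).
  have M := @derive1_at_max R (rad_ratio q) 0 1 s0.
  apply: M.
  - exact: ler01.
  - by move=> t; rewrite in_itv /= => /andP[/dv].
  - by rewrite in_itv /= s00.
  - move=> t; rewrite in_itv /= => /andP[t0 t1]; rewrite ratio0.
    have := rad0 t; rewrite pgf_radicandE ?gt_eqF// t0 (ltW t1) => /(_ isT).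
    by rewrite pmulr_rge0 ?exprn_gt0// subr_ge0.
have [|||c] := @Rolle _ (rad_ratio q) _ _ s01.
- by move=> t; rewrite in_itv /= => /andP[st _]; apply: dv; lra.
- apply: (is_derive_within_continuous (rad_ratio q)
    (fun s => expR (alpha * (s - 1)) * crit_poly q s / s ^+ 3) s0 1) => x /andP[sx _].
  by apply: d; lra.
- by rewrite ratio0 rad_ratio1.
rewrite in_itv /= => c01 dc; exists c => //.
by apply: crit0 => //; lra.
Qed.

(** Vieta: the sum of the roots is read off the coefficients and the discriminant is the square of
    [A * (s1 - s0)], so the formula with the minus sign is the smaller root. *)
Lemma crit_polyE q s0 s1 : 0 < alpha * (1 + q) -> s0 < s1 ->
  crit_poly q s0 = 0 -> crit_poly q s1 = 0 ->
  [/\ 0 < s_discr alpha q, s0 = s_crit alpha q &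
      (s0 + s1) * (alpha * (1 + q)) = 1 + (1 + alpha) * q].
Proof.
rewrite /crit_poly /s_crit /s_discr.
set A := alpha * (1 + q); set B := 1 + (1 + alpha) * q => A0 s01 e0 e1.
have sumE : (s0 + s1) * A = B.
  have : (s1 - s0) * ((s0 + s1) * A - B) = 0.
    transitivity ((A * s1 ^+ 2 - B * s1 + 2 * q) - (A * s0 ^+ 2 - B * s0 + 2 * q)).
      by ring.
    by rewrite e0 e1 subrr.
  by move=> /eqP; rewrite mulf_eq0 !subr_eq0 gt_eqF//= => /eqP.
have discE : B ^+ 2 - 8 * alpha * q * (1 + q) = (A * (s1 - s0)) ^+ 2.
  transitivity (B ^+ 2 - 4 * A * (2 * q)); first by rewrite /A; ring.
  have -> : 2 * q = B * s0 - A * s0 ^+ 2 by lra.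
  by rewrite -sumE; ring.
rewrite discE sqrtr_sqr ger0_norm; last by rewrite mulr_ge0// ?ltW// subr_gt0.
have A_neq0 : A != 0 by rewrite gt_eqF.
split => //.
  by rewrite exprn_gt0// mulr_gt0// subr_gt0.
rewrite -mulrA -/A -sumE; field.
by rewrite A_neq0.
Qed.

(** At [q = 1 - alpha] the polynomial is [1 - s] times an affine function of [s], whose value at 1
    is [alpha ^+ 2 - 4 * alpha + 2], with smaller root [2 - Num.sqrt 2] in [alpha]. The coefficient
    of [q] is positive. *)
Lemma crit_poly_gt0 q s : alpha <= 2 - Num.sqrt 2 -> 1 - alpha <= q -> 0 < s < 1 ->
  0 < crit_poly q s.
Proof.
move=> a2 aq /andP[s0 s1].
have sqrt2 : Num.sqrt 2 ^+ 2 = 2 :> R by rewrite sqr_sqrtr.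
have sqrt2_ge1 : 1 <= Num.sqrt 2 :> R by rewrite -{1}sqrtr1 ler_sqrt// ler1n.
have a1 : alpha <= 1 by lra.
have -> : crit_poly q s = (1 - s) * (2 * (1 - alpha) - alpha * (2 - alpha) * s) +
    (q - (1 - alpha)) * ((1 - s) * (1 - alpha * s) + 1).
  by rewrite /crit_poly; ring.
have as1 : alpha * s <= 1 by rewrite mulr_ile1// ltW.
rewrite ltr_pwDl//; last first.
  by rewrite mulr_ge0// ?subr_ge0// addr_ge0// mulr_ge0// subr_ge0// ltW.
rewrite mulr_gt0// ?subr_gt0//.
have d0 : 0 <= alpha ^+ 2 - 4 * alpha + 2.
  have -> : alpha ^+ 2 - 4 * alpha + 2 = (2 - Num.sqrt 2 - alpha) * (2 + Num.sqrt 2 -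
    alpha).
    by transitivity (alpha ^+ 2 - 4 * alpha + 4 - Num.sqrt 2 ^+ 2); [rewrite sqrt2;
      ring|ring].
  by rewrite mulr_ge0//; lra.
have [->|a_neq0] := eqVneq alpha 0; first lra.
have a_gt0 : 0 < alpha by rewrite lt_def a_neq0.
have : alpha * (2 - alpha) * s < alpha * (2 - alpha) * 1.
  by rewrite ltr_pM2l// mulr_gt0//; lra.
by lra.
Qed.

Hypothesis G01 : forall s, 0 <= s <= 1 -> 0 <= G s <= 1.
Hypothesis G_lip : forall t s, 0 <= t -> t <= s -> s < 1 ->
  G t <= G s <= G t + (s - t) / (1 - s).
Hypothesis G_near0 : forall s, 0 <= s <= 1 -> G 0 <= G s <= G 0 + s.
Hypothesis G_quad : forall s, 0 < s <= 1 ->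
  4 * s ^+ 2 * G s = expR (alpha * (s - 1)) * (G s - G 0 + s * (1 + G 0)) ^+ 2.

(* The square root of the radicand, with the sign determined by [G]. *)
Definition branch s : R :=
  (G s - p + s * (1 + p)) / (2 * s * expR (alpha * (1 - s))) - s.

Let expRVE s : expR (alpha * (s - 1)) = (expR (alpha * (1 - s)))^-1.
Proof. by rewrite -expRN -mulrN opprB. Qed.

Lemma pgf_branchE s : 0 < s -> G s = p - s * (1 + p)
  + 2 * s ^+ 2 * expR (alpha * (1 - s)) + 2 * s * expR (alpha * (1 - s)) * branch s.
Proof.
move=> s0; rewrite /branch; field.
by rewrite !gt_eqF// expR_gt0.
Qed.

(** This is the quadratic equation for [G s] with the square completed. *)
Lemma branch_sqr s : 0 < s <= 1 -> branch s ^+ 2 = pgf_radicand p s.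
Proof.
move=> s01; have s0 : s != 0 by rewrite gt_eqF//; lra.
have e0 : expR (alpha * (1 - s)) != 0 by rewrite gt_eqF// expR_gt0.
have := G_quad _ s01; rewrite /pgf_radicand /branch expRVE.
set e := expR _; set Y := G s - p + s * (1 + p) => E.
have YE : Y ^+ 2 = 4 * s ^+ 2 * G s * e by rewrite E; field.
transitivity (Y ^+ 2 / (4 * s ^+ 2 * e ^+ 2) - Y / e + s ^+ 2); first by field;
  rewrite s0 e0.
by rewrite YE /Y; field; rewrite s0 e0.
Qed.

Lemma radicand_ge0 s : 0 <= s <= 1 -> 0 <= pgf_radicand p s.
Proof.
move=> s01; have [s0|s0] := eqVneq s 0.
  rewrite s0 /pgf_radicand expr0n /= mul0r !sub0r mulrN opprK mulr_ge0 ?expR_ge0//.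
  by case/andP: (G01 0 ltac:(by rewrite lexx ler01)).
by rewrite -branch_sqr ?sqr_ge0//; move: s0; rewrite neq_lt; case/orP; lra.
Qed.

Lemma branch_eq0 s : 0 < s <= 1 -> branch s = 0 -> pgf_radicand p s = 0.
Proof. by move=> s01 b0; rewrite -branch_sqr// b0 expr0n. Qed.

Lemma pgf_sqrtE s : 0 < s <= 1 -> 0 <= branch s ->
  G s = p - s * (1 + p) + 2 * s ^+ 2 * expR (alpha * (1 - s))
    + 2 * s * expR (alpha * (1 - s)) * Num.sqrt (pgf_radicand p s).
Proof.
move=> s01 b0; rewrite -branch_sqr// sqrtr_sqr ger0_norm// -pgf_branchE//.
by case/andP: s01.
Qed.

Lemma pgf_sqrtNE s : 0 < s <= 1 -> branch s <= 0 ->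
  G s = p - s * (1 + p) + 2 * s ^+ 2 * expR (alpha * (1 - s))
    - 2 * s * expR (alpha * (1 - s)) * Num.sqrt (pgf_radicand p s).
Proof.
move=> s01 b0; rewrite -branch_sqr// sqrtr_sqr ler0_norm// mulrN opprK -pgf_branchE//.
by case/andP: s01.
Qed.

(** Otherwise the radicand, zero at 1 with slope [1 - alpha - p], would be negative just before
    1. *)
Lemma p_ge : 1 - alpha <= p.
Proof.
rewrite leNgt; apply/negP => pa.
have [|b b1 kb] := derive_pos_lt0_left _ _ _ (pgf_radicand1 p) (is_derive_radicand1 p).
  by lra.
pose c := Num.max b 0.
have c1 : c < 1 by rewrite /c gt_max b1 ltr01.
have bc : b <= c by rewrite /c le_max lexx.
have c0 : 0 <= c by rewrite /c le_max lexx orbT.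
have := kb ((c + 1) / 2) ltac:(lra); apply/negP; rewrite -leNgt radicand_ge0//; lra.
Qed.

Lemma p_itv : 0 <= p <= 1.
Proof. by apply: G01; rewrite lexx ler01. Qed.

(** Dividing the quadratic equation by [s ^+ 2] and letting [s] tend to 0 gives
    [expR (- alpha) * (1 + p) ^+ 2 <= 4 * p]; in particular [p] is positive, which makes the final
    bound strict. *)
Lemma p_lower : expR (- alpha) / 4 < p.
Proof.
have /andP[p0 p1] := p_itv.
have e0 : 0 < expR (- alpha) by rewrite expR_gt0.
have e1 : expR (- alpha) <= 1 by rewrite -expR0 ler_expR oppr_le0.
suff le : expR (- alpha) * (1 + p) ^+ 2 <= 4 * p.
  have p_gt0 : 0 < p.
    have : 0 < expR (- alpha) * (1 + p) ^+ 2 by rewrite mulr_gt0// exprn_gt0//; lra.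
    lra.
  have : expR (- alpha) * 1 < expR (- alpha) * (1 + p) ^+ 2.
    rewrite ltr_pM2l//; nra.
  lra.
rewrite [leRHS]mulrC; apply/ler_addgt0Pr => e e_gt0.
(* As [G s <= p + s], this choice makes [4 * G s] at most [4 * p + e]. *)
pose s := Num.min (e / 4) 1.
have s01 : 0 < s <= 1 by rewrite /s lt_min ltr01 divr_gt0//= ge_min lexx orbT.
have s01' : 0 <= s <= 1 by lra.
have se : s <= e / 4 by rewrite /s ge_min lexx.
have [/andP[Gp Gps] E] := (G_near0 _ s01', G_quad _ s01).
have s2 : 0 < s ^+ 2 by rewrite exprn_gt0//; lra.
have : s ^+ 2 * (expR (- alpha) * (1 + p) ^+ 2) <= s ^+ 2 * (4 * G s).
  have -> : s ^+ 2 * (4 * G s) = 4 * s ^+ 2 * G s by ring.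
  rewrite E mulrCA -exprMn; apply: ler_pM.
  - exact: ltW.
  - by rewrite exprn_ge0// mulr_ge0//; lra.
  - by rewrite ler_expR; have := mulr_ge0 alpha_ge0 (ltW (andP s01).1); lra.
  - have sp : 0 <= s * (1 + p) by rewrite mulr_ge0//; lra.
    by apply: lerXn2r; rewrite ?nnegrE; lra.
rewrite ler_pM2l//; lra.
Qed.

(** Since [p <= G s], the fraction in [branch] is at least [expR (- alpha) / 2]. *)
Lemma branch_gt0_near0 s : 0 < s -> s < expR (- alpha) / 2 -> 0 < branch s.
Proof.
move=> s0 se.
have e1 : expR (- alpha) <= 1 by rewrite -expR0 ler_expR oppr_le0.
have s01 : 0 <= s <= 1 by lra.
have /andP[Gp _] := G_near0 _ s01; have /andP[p0 p1] := p_itv.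
have c0 : 0 < 2 * s * expR (alpha * (1 - s)) by rewrite !mulr_gt0// expR_gt0.
rewrite /branch subr_gt0 ltr_pdivlMr//.
have es : s * expR (alpha * (1 - s)) <= s * expR alpha.
  rewrite ler_pM2l// ler_expR ler_piMr//; lra.
have : s * expR alpha < 1 / 2.
  have : s * expR alpha < expR (- alpha) / 2 * expR alpha by rewrite ltr_pM2r// expR_gt0.
  by rewrite mulrAC -expRD addNr expR0.
move=> h.
have : s * (2 * (s * expR (alpha * (1 - s)))) < s * (1 + p).
  by rewrite ltr_pM2l//; lra.
lra.
Qed.

Lemma G_continuous x : 0 < x < 1 -> {for x, continuous G}.
Proof.
move=> /andP[x0 x1]; apply/cvgrPdist_le => e e0.
(* Below the midpoint [b] of [x] and 1, [G] is Lipschitz with constant [1 / (1 - b)]. *)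
pose b := (x + 1) / 2.
have b1 : 0 < 1 - b by rewrite /b; lra.
near=> t.
have t0 : 0 < t by near: t; exact: lt_nbhsr.
have tb : t < b by near: t; apply: lt_nbhsl; rewrite /b; lra.
have xb : x < b by rewrite /b; lra.
have xte : `|x - t| <= e * (1 - b).
  by near: t; apply: (@cvgr_dist_le _ R^o _ _ _ id) => //; rewrite mulr_gt0.
have half u v : 0 < u -> u <= v -> v < b -> `|u - v| <= e * (1 - b) -> `|G u - G v| <= e.
  move=> u0 uv vb uve; have := G_lip u v (ltW u0) uv ltac:(lra).
  move=> /andP[Guv Gvu]; rewrite distrC ger0_norm ?subr_ge0//.
  rewrite lerBlDl (le_trans Gvu)// lerD2l ler_pdivrMr ?subr_gt0//; last lra.
  move: uve; rewrite distrC ger0_norm ?subr_ge0// => /le_trans; apply.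
  by rewrite ler_pM2l// lerD2l lerN2 ltW.
have [xt|tx] := leP x t; first exact: half.
by rewrite distrC; apply: half => //; rewrite 1?distrC// ltW.
Unshelve. all: by end_near. Qed.

Lemma branch_ivt a b : 0 < a -> a <= b -> b < 1 ->
  Num.min (branch a) (branch b) <= 0 <= Num.max (branch a) (branch b) ->
  exists2 c, a <= c <= b & branch c = 0.
Proof.
move=> a0 ab b1 sgn.
have [|c] := @IVT _ branch a b 0 ab _ sgn; last by rewrite in_itv /=; exists c.
apply/continuous_in_subspaceT => x; rewrite inE /= in_itv /= => /andP[ax xb].
have x01 : 0 < x < 1 by lra.
have x_neq0 : 2 * x * expR (alpha * (1 - x)) != 0.
  by rewrite !mulf_neq0// gt_eqF// ?expR_gt0; lra.
rewrite /branch; apply: cvgB; last exact: cvg_id.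
apply: cvgM.
  apply: cvgD.
    by apply: cvgB; [exact: G_continuous|exact: cvg_cst].
  by apply: cvgM; [exact: cvg_id|exact: cvg_cst].
apply: cvgV => //; apply: cvgM.
  by apply: cvgM; [exact: cvg_cst|exact: cvg_id].
apply: continuous_comp; last exact: continuous_expR.
apply: cvgM; first exact: cvg_cst.
by apply: cvgB; [exact: cvg_cst|exact: cvg_id].
Qed.

Lemma branch_zero b : 0 < b < 1 -> branch b <= 0 ->
  exists2 c, 0 < c <= b & branch c = 0.
Proof.
move=> /andP[b0 b1] fb; have e0 : 0 < expR (- alpha) by rewrite expR_gt0.
pose a := Num.min b (expR (- alpha) / 4).
have a0 : 0 < a by rewrite /a lt_min b0 divr_gt0.
have ab : a <= b by rewrite /a ge_min lexx.
have ae : a <= expR (- alpha) / 4 by rewrite /a ge_min lexx orbT.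
have fa : 0 < branch a by apply: branch_gt0_near0 => //; lra.
have [|c c_itv fc] := branch_ivt a b a0 ab b1.
  by rewrite ge_min fb orbT le_max (ltW fa).
by exists c => //; lra.
Qed.

Lemma branch_crit s : 0 < s < 1 -> branch s = 0 ->
  crit_poly p s = 0 /\ exists2 s1, s < s1 < 1 & crit_poly p s1 = 0.
Proof.
move=> s01 fs; apply: crit_poly_roots => //.
  by move=> t t01; apply: radicand_ge0; lra.
by apply: branch_eq0 => //; lra.
Qed.

Definition pgf_poly s y : R :=
  (y - p + s * (1 + p)) ^+ 2 - 4 * s ^+ 2 * expR (alpha * (1 - s)) * y.

Lemma pgf_poly_root s : 0 < s <= 1 -> pgf_poly s (G s) = 0.
Proof.
move=> s01; rewrite /pgf_poly mulrAC G_quad// expRVE; field.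
by rewrite gt_eqF// expR_gt0.
Qed.

(** Along every line through the point (1, 1) the polynomial vanishes at [s = 1] with slope
    [4 * (p - (1 - alpha))], whatever [m] is. *)
Lemma pgf_poly_lt0 m : 1 - alpha < p ->
  exists2 b, b < 1 & forall s, b < s < 1 -> pgf_poly s (1 - m * (1 - s)) < 0.
Proof.
move=> ap.
have dY := is_derive_affine (m + 1 + p) (1 - m - p) 1.
have dE := is_derive_expR_affine (- alpha) 1 1.
have dS := @is_derive_affine R 1 0 1.
have dy := is_derive_affine m (1 - m) 1.
have := is_deriveB1 _ _ _ _ _ (is_deriveM1 _ _ _ _ _ dY dY)
  (is_deriveM1 _ _ _ _ _ (@is_derive_affine R 4 0 1)
    (is_deriveM1 _ _ _ _ _ dS (is_deriveM1 _ _ _ _ _ dE dy))).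
set F := (fun x => _); set dF := (X in is_derive _ _ _ X) => d.
have FE s : F s = pgf_poly s (1 - m * (1 - s)).
  rewrite /F /pgf_poly (_ : - alpha * (s - 1) = alpha * (1 - s)); ring.
have dFE : dF = 4 * (p - (1 - alpha)).
  by rewrite /dF subrr !mulr0 expR0; ring.
have [||b b1 Fb] := derive_pos_lt0_left _ _ _ _ d.
- by rewrite FE /pgf_poly subrr !mulr0 expR0; ring.
- by rewrite dFE mulr_gt0// subr_gt0.
by exists b => // s /Fb; rewrite FE.
Qed.

(* [G <= 1] selects the smaller root where the quadratic is negative at [1]. *)
Lemma pgf_lt_of_poly s m : 0 < s < 1 -> 0 <= m -> pgf_poly s 1 < 0 ->
  pgf_poly s (1 - m * (1 - s)) < 0 -> G s < 1 - m * (1 - s).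
Proof.
move=> s01 m0 q1 qm; rewrite ltNge; apply/negP => mG.
have s01' : 0 < s <= 1 by lra.
have G1 : G s <= 1 by case/andP: (G01 s ltac:(lra)).
have ms : 0 <= m * (1 - s) by rewrite mulr_ge0//; lra.
move: (pgf_poly_root _ s01') q1 qm; rewrite /pgf_poly.
set g := G s in mG G1 *; set e := expR _; set y := 1 - m * (1 - s) in mG *.
set c := s * (1 + p) - p; set k := 4 * s ^+ 2 * e.
have shift z : z - p + s * (1 + p) = z + c by rewrite /c; ring.
rewrite !shift => qg q1 qy.
(* Convexity of a monic quadratic at the three points [y <= g <= 1], where [g] is a root. *)
have id : (1 - g) * ((y + c) ^+ 2 - k * y) + (g - y) * ((1 + c) ^+ 2 - k * 1)
   = (1 - g) * (g - y) * (1 - y) + (1 - y) * ((g + c) ^+ 2 - k * g) by ring.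
have y1 : y <= 1 by rewrite /y; lra.
have r0 : 0 <= (1 - g) * (g - y) * (1 - y) by rewrite !mulr_ge0//; lra.
rewrite qg mulr0 addr0 in id.
have [g1|g1] := eqVneq g 1; first by rewrite -g1 qg ltxx in q1.
have g1' : 0 < 1 - g by rewrite subr_gt0 lt_neqAle g1.
have t1 : (1 - g) * ((y + c) ^+ 2 - k * y) < 0 by rewrite pmulr_rlt0.
have t2 : (g - y) * ((1 + c) ^+ 2 - k * 1) <= 0.
  by rewrite mulr_ge0_le0//; [lra|exact: ltW].
lra.
Qed.

(** A nonnegative [branch] makes [G s] the larger root; as [G s <= 1], the quadratic would be
    nonnegative at 1. *)
Lemma branch_lt0_of_poly s : 0 < s < 1 -> pgf_poly s 1 < 0 -> branch s < 0.
Proof.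
move=> s01 q1; rewrite ltNge; apply/negP => b0.
have s01' : 0 < s <= 1 by lra.
have G1 : G s <= 1 by case/andP: (G01 s ltac:(lra)).
have e0 : 0 < expR (alpha * (1 - s)) by rewrite expR_gt0.
have YE : G s - p + s * (1 + p) = 2 * s ^+ 2 * expR (alpha * (1 - s)) +
    2 * s * expR (alpha * (1 - s)) * branch s.
  by rewrite {1}pgf_branchE; [ring|lra].
have Yge : 0 <= 2 * s * expR (alpha * (1 - s)) * branch s.
  by rewrite !mulr_ge0//; lra.
have id : pgf_poly s 1 - pgf_poly s (G s) = (1 - G s) *
    (2 * (G s - p + s * (1 + p) - 2 * s ^+ 2 * expR (alpha * (1 - s))) + (1 - G s)).
  by rewrite /pgf_poly; ring.
have : 0 <= pgf_poly s 1 - pgf_poly s (G s).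
  by rewrite id mulr_ge0//; [lra|rewrite YE; lra].
by rewrite pgf_poly_root//; lra.
Qed.

(** Near 1 the graph of [G] lies below every line through (1, 1): the slope at 1 is infinite, and so
    will be the mean. *)
Lemma pgf_steep_at1 : 1 - alpha < p -> forall m, 0 <= m ->
  exists2 s, 0 < s < 1 & G s < 1 - m * (1 - s).
Proof.
(* The case [m = 0] supplies the negativity at [y = 1]. *)
move=> ap m m0; have [b b1 qb] := pgf_poly_lt0 0 ap.
have [b' b'1 qb'] := pgf_poly_lt0 m ap.
pose c := Num.max 0 (Num.max b b').
have [c0 bc bc'] : [/\ 0 <= c, b <= c & b' <= c] by rewrite /c !le_max !lexx !orbT.
have c1 : c < 1 by rewrite /c !gt_max ltr01 b1 b'1.
exists ((c + 1) / 2); first lra.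
apply: pgf_lt_of_poly => //; first lra.
- by have := qb ((c + 1) / 2); rewrite mul0r subr0; apply; lra.
- by apply: qb'; lra.
Qed.

Lemma branch_neg_near1 : 1 - alpha < p ->
  exists2 b, b < 1 & forall s, 0 < s -> b < s < 1 -> branch s < 0.
Proof.
move=> ap; have [b b1 qb] := pgf_poly_lt0 0 ap.
exists b => // s s0 sb; apply: branch_lt0_of_poly; first lra.
by have := qb s sb; rewrite mul0r subr0.
Qed.

Lemma pgf_subcritical : alpha <= 2 - Num.sqrt 2 -> p = 1 - alpha.
Proof.
move=> a2; apply/eqP; rewrite eq_le p_ge andbT leNgt; apply/negP => ap.
have [b b1 fb] := branch_neg_near1 ap.
pose c := Num.max 0 b.
have [c0 bc] : 0 <= c /\ b <= c by rewrite /c !le_max !lexx orbT.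
have c1 : c < 1 by rewrite /c gt_max ltr01 b1.
have [||s s_itv fs] := branch_zero ((c + 1) / 2); first lra.
  by apply/ltW/fb; lra.
have s01 : 0 < s < 1 by lra.
have [] := branch_crit _ s01 fs.
by move=> + _; apply/eqP; rewrite gt_eqF// crit_poly_gt0//; exact: p_ge.
Qed.

Lemma branch_pos_subcritical s : alpha <= 2 - Num.sqrt 2 -> 0 < s < 1 -> 0 < branch s.
Proof.
move=> a2 s01; rewrite ltNge; apply/negP => fs.
have [c c_itv fc] := branch_zero _ s01 fs.
have c01 : 0 < c < 1 by lra.
have [] := branch_crit _ c01 fc.
by move=> + _; apply/eqP; rewrite gt_eqF// crit_poly_gt0//; exact: p_ge.
Qed.

Lemma p_gt_supercritical : 2 - Num.sqrt 2 < alpha -> 1 - alpha < p.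
Proof.
move=> a2; rewrite lt_neqAle p_ge andbT; apply/eqP => pE.
have /andP[p0 p1] := p_itv.
have sqrt2 : Num.sqrt 2 ^+ 2 = 2 :> R by rewrite sqr_sqrtr.
have sqrt2_ge1 : 1 <= Num.sqrt 2 :> R by rewrite -{1}sqrtr1 ler_sqrt// ler1n.
have sqrt2_le2 : Num.sqrt 2 < 2 :> R by nra.
have a1 : alpha <= 1 by lra.
have A0 : 0 < alpha * (2 - alpha) by rewrite mulr_gt0//; lra.
have lt : 2 * (1 - alpha) < alpha * (2 - alpha).
  rewrite -subr_gt0 (_ : _ - _ = (alpha - (2 - Num.sqrt 2)) * (2 + Num.sqrt 2 - alpha)).
    by rewrite mulr_gt0//; lra.
  transitivity (4 * alpha - alpha ^+ 2 - 4 + Num.sqrt 2 ^+ 2); [rewrite sqrt2; ring|ring].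
(* [r] is the zero of the affine factor of [crit_poly p]; beyond it the polynomial is negative,
   which makes the radicand negative at the midpoint [c] of [r] and 1. *)
pose r := 2 * (1 - alpha) / (alpha * (2 - alpha)).
have r1 : r < 1 by rewrite /r ltr_pdivrMr// mul1r.
have r0 : 0 <= r by rewrite /r divr_ge0 ?(ltW A0)//; lra.
pose c := (r + 1) / 2.
have c01 : 0 < c < 1 by rewrite /c; lra.
suff /(rad_ratio_gt1 _ _ c01) : forall s, c < s < 1 -> crit_poly p s < 0.
  apply/negP; rewrite -leNgt.
  have : 0 <= pgf_radicand p c by apply: radicand_ge0; lra.
  rewrite pgf_radicandE; last by rewrite gt_eqF//; lra.
  by rewrite pmulr_rge0 ?subr_ge0// exprn_gt0//; lra.
move=> s s_itv.
have -> : crit_poly p s = (1 - s) * (2 * (1 - alpha) - alpha * (2 - alpha) * s).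
  by rewrite /crit_poly -pE; ring.
rewrite pmulr_rlt0; last lra.
have : r < s by rewrite /c in s_itv; lra.
by rewrite /r ltr_pdivrMr// => h; lra.
Qed.

(* Beyond the critical value, [branch] changes sign at a double zero of the
   radicand, which must be [s_crit]. *)
Lemma supercritical_zero : 2 - Num.sqrt 2 < alpha ->
  [/\ 0 < s_crit alpha p < 1, 0 < s_discr alpha p,
   (forall s, 0 < s <= s_crit alpha p -> 0 <= branch s),
   (forall s, s_crit alpha p < s < 1 -> branch s <= 0) &
   exists2 s1, s_crit alpha p < s1 &
     [/\ pgf_radicand p (s_crit alpha p) = 0 &
      (s_crit alpha p + s1) * (alpha * (1 + p)) = 1 + (1 + alpha) * p]].
Proof.
move=> a2; have ap := p_gt_supercritical a2.
have /andP[p0 p1] := p_itv.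
have a_gt0 : 0 < alpha by rewrite lt_def alpha_ge0 andbT; apply/eqP => a0; lra.
have A0 : 0 < alpha * (1 + p) by rewrite mulr_gt0//; lra.
(* Each zero of [branch] is the smaller of two roots of [crit_poly p], so there is at most one. *)
have zeroE s : 0 < s < 1 -> branch s = 0 -> s = s_crit alpha p.
  move=> s01 /(branch_crit _ s01)[e0 [s1 s1_itv e1]].
  by have [] := crit_polyE p s s1 A0 ltac:(lra) e0 e1.
have [b b1 fb] := branch_neg_near1 ap.
have near1 t : t < 1 -> exists2 c, t < c < 1 & 0 < c /\ branch c < 0.
  move=> t1; pose c := Num.max t (Num.max 0 b).
  have [tc c0 bc] : [/\ t <= c, 0 <= c & b <= c] by rewrite /c !le_max !lexx !orbT.
  have c1 : c < 1 by rewrite /c !gt_max ltr01 b1 t1.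
  by exists ((c + 1) / 2); [lra|split; [lra|apply: fb; lra]].
have [c c01 [_ fc]] := near1 0 ltr01.
have [s0 s0_itv f0] := branch_zero _ c01 (ltW fc).
have s001 : 0 < s0 < 1 by lra.
have [e0 [s1 s1_itv e1]] := branch_crit _ s001 f0.
have [disc s0E sumE] := crit_polyE p s0 s1 A0 ltac:(lra) e0 e1.
rewrite -s0E; split => //.
(* A negative value at [s] forces a zero in ]0, s]; it is [s0], hence [s = s0], where [branch]
   vanishes. *)
- move=> s s_itv; rewrite leNgt; apply/negP => fs.
  have s01 : 0 < s < 1 by lra.
  have [t t_itv ft] := branch_zero _ s01 (ltW fs).
  have t01 : 0 < t < 1 by lra.
  have ts0 : t = s0 by rewrite s0E; exact: zeroE.
  have ss0 : s = s0 by lra.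
  by move: fs; rewrite ss0 f0 ltxx.
(* A positive value at [s] and a negative one nearer to 1 would enclose a second zero. *)
- move=> s s_itv; rewrite leNgt; apply/negP => fs.
  have [t t_itv [t0 ft]] := near1 s (andP s_itv).2.
  have [s_gt0 st t1] : [/\ 0 < s, s <= t & t < 1] by split; lra.
  have [|u u_itv fu] := branch_ivt s t s_gt0 st t1.
    by rewrite ge_min (ltW ft) orbT le_max (ltW fs).
  have u01 : 0 < u < 1 by lra.
  have := zeroE u u01 fu; lra.
- exists s1; first by lra.
  by split => //; apply: branch_eq0 => //; lra.
Qed.

(** With [k] and [K] equal to 3 minus and plus [2 * Num.sqrt 2], the discriminant factors as
    [((alpha - k) * p - k) * ((alpha - K) * p - K)]. It is positive, and the sum of the roots
    excludes that both factors are. *)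
Lemma p_lt_c_bound : 2 - Num.sqrt 2 < alpha -> p < c_bound alpha.
Proof.
move=> a2; have [s01 disc _ _ [s1 ss1 [rad0 sumE]]] := supercritical_zero a2.
have /andP[p0 p1] := p_itv.
have e0 : 0 < expR (- alpha) by rewrite expR_gt0.
have p_gt0 : 0 < p by have := p_lower; lra.
move: disc s01 ss1 rad0 sumE; set s := s_crit alpha p => disc s01 ss1 rad0 sumE.
have sqrt2 : Num.sqrt 2 ^+ 2 = 2 :> R by rewrite sqr_sqrtr.
have sqrt2_gt : 1 < Num.sqrt 2 :> R by rewrite -{1}sqrtr1 ltr_sqrt// ltr1n.
have sqrt2_lt : Num.sqrt 2 < 3 / 2 :> R by nra.
move: a2 sqrt2 sqrt2_gt sqrt2_lt; rewrite /c_bound; set r2 := Num.sqrt 2.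
move=> a2 sqrt2 sqrt2_gt sqrt2_lt.
pose k := 3 - 2 * r2; pose K := 3 + 2 * r2.
have kK : k * K = 1 by rewrite /k /K; transitivity (9 - 4 * r2 ^+ 2);
  [ring|rewrite sqrt2; ring].
have k0 : 0 < k by rewrite /k; lra.
have ak : 0 < alpha - k by rewrite /k; lra.
(* Cancelling [alpha - K] merges the two cases of [c_bound]. *)
have cE : c_bound alpha = k / (alpha - k).
  rewrite /c_bound -/r2; have [aE|aK] := eqVneq alpha (3 + 2 * r2).
    apply/eqP; rewrite eq_sym eqr_div ?pnatr_eq0//; last by rewrite lt0r_neq0.
    apply/eqP.
    rewrite aE /k; transitivity (24 - 16 * r2 : R); first by ring.
    transitivity (12 * r2 ^+ 2 - 16 * r2 : R); [by rewrite sqrt2; ring|by ring].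
  have aK0 : alpha - K != 0 by rewrite subr_eq0.
  have -> : (3 - 2 * r2) * alpha - 1 = k * (alpha - K).
    by rewrite mulrBr kK.
  have -> : alpha ^+ 2 - 6 * alpha + 1 = (alpha - k) * (alpha - K).
    transitivity (alpha ^+ 2 - (k + K) * alpha + k * K); last by ring.
    by rewrite kK /k /K; ring.
  by field; rewrite aK0 gt_eqF.
have discE : s_discr alpha p = ((alpha - k) * p - k) * ((alpha - K) * p - K).
  transitivity (((alpha - k) * (alpha - K)) * p ^+ 2 + (2 - 6 * alpha) * p + k * K);
    last first.
    transitivity (((alpha - k) * (alpha - K)) * p ^+ 2 + (2 * (k * K) - (k + K) *
      alpha) * p + k * K); last by ring.
    by rewrite kK /k /K; congr (_ + _ * _ + _); ring.
  have -> : (alpha - k) * (alpha - K) = alpha ^+ 2 - 6 * alpha + k * K.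
    transitivity (alpha ^+ 2 - (k + K) * alpha + k * K); first by ring.
    by rewrite /k /K; ring.
  by rewrite kK /s_discr; ring.
have num_gt0 : 0 < s * (1 + p) - p.
  have s2 : 0 < s ^+ 2 by rewrite exprn_gt0//; lra.
  have E : 0 < expR (alpha * (s - 1)) by rewrite expR_gt0.
  have : expR (alpha * (s - 1)) * (s * (1 + p) - p) = s ^+ 2.
    by move: rad0; rewrite /pgf_radicand => /eqP; rewrite subr_eq0 => /eqP.
  by move=> e; rewrite -(pmulr_rgt0 _ E) e.
(* By [num_gt0], [2 * p] is less than [(s + s1) * (1 + p)], and [sumE] evaluates this sum. *)
have ap1 : alpha * p < 1 + p.
  have a_gt0 : 0 < alpha by lra.
  have : 2 * p * alpha < (s + s1) * (1 + p) * alpha.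
    rewrite ltr_pM2r//; have : s * (1 + p) < s1 * (1 + p) by rewrite ltr_pM2r//; lra.
    lra.
  lra.
(* Otherwise both factors are positive, so [K + K * p < alpha * p < 1 + p], impossible since
   [1 < K]. *)
have goal : (alpha - k) * p < k.
  rewrite ltNge; apply/negP => kp.
  have f1 : 0 < (alpha - K) * p - K.
    rewrite ltNge; apply/negP => f1; move: disc; rewrite discE; apply/negP;
      rewrite -leNgt.
    by rewrite mulr_ge0_le0// subr_ge0.
  have : K * p > 1 * p by rewrite ltr_pM2r// /K; lra.
  have : 1 < K by rewrite /K; lra.
  lra.
by rewrite -/(c_bound alpha) cE ltr_pdivlMr// mulrC.
Qed.

End pgf_analysis.

(** * The mean *)

Section expR_bounds.
Context {R : realType}.
Implicit Types x y : R.

(** It serves the Taylor bounds below: the derivative of each remainder is, up to sign, the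
    remainder one order lower. *)
Lemma ge0_of_derive_ge0 (F dF : R -> R) x : F 0 = 0 -> 0 <= x ->
  (forall y, 0 <= y -> is_derive y 1 F (dF y)) -> (forall y, 0 <= y -> 0 <= dF y) ->
  0 <= F x.
Proof.
move=> F0; rewrite le_eqVlt => /predU1P[<-|x0] d dF0; first by rewrite F0.
have [||c] := @MVT _ F dF _ _ x0.
- by move=> y; rewrite in_itv /= => /andP[y0 _]; apply: d; exact: ltW.
- by apply: (is_derive_within_continuous F dF 0 x) => y /andP[y0 _]; exact: d.
rewrite in_itv /= => /andP[c0 _]; rewrite F0 !subr0 => ->.
by rewrite mulr_ge0 ?(ltW x0)// dF0// ltW.
Qed.

Let is_derive_expRN x : is_derive x 1 (fun y : R => expR (- y)) (- expR (- x)).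
Proof.
have := is_derive_expR_affine (- 1 : R) 0 x.
rewrite subr0 !mulN1r => d.
rewrite (_ : (fun y => expR (- y)) = fun y => expR (- 1 * (y - 0)))//.
by apply/funext => y; rewrite subr0 mulN1r.
Qed.

Lemma expRN_le2 x : 0 <= x -> expR (- x) <= 1 - x + x ^+ 2 / 2.
Proof.
move=> x0; rewrite -subr_ge0.
apply: (ge0_of_derive_ge0 (fun y => 1 - y + y ^+ 2 / 2 - expR (- y))
   (fun y => (y - 1) + expR (- y))) => //.
- by rewrite oppr0 expR0 expr0n /=; ring.
- move=> y _.
  have := is_deriveB1 _ _ _ _ _ (is_deriveM1 _ _ _ _ _ (is_derive_affine (1 / 2) (- 1) y)
    (is_derive_affine 1 0 y)) (is_derive_expRN y).
  set F := (fun z => _) => d.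
  have -> : (fun z : R => 1 - z + z ^+ 2 / 2 - expR (- z)) = F \+ cst 1.
    by apply/funext => z; rewrite /F /=; field.
  have := is_deriveD d (is_derive_cst (1 : R) y 1) => d'.
  by apply: (is_derive_eq d'); field.
- by move=> y y0; have := expR_ge1Dx (- y); lra.
Qed.

Lemma expRN_ge3 x : 0 <= x -> 1 - x + x ^+ 2 / 2 - x ^+ 3 / 6 <= expR (- x).
Proof.
move=> x0; rewrite -subr_ge0.
apply: (ge0_of_derive_ge0 (fun y => expR (- y) - (1 - y + y ^+ 2 / 2 - y ^+ 3 / 6))
   (fun y => (1 - y + y ^+ 2 / 2) - expR (- y))) => //.
- by rewrite oppr0 expR0 !expr0n /=; ring.
- move=> y _.
  have := is_deriveB1 _ _ _ _ _ (is_derive_expRN y) (is_deriveM1 _ _ _ _ _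
    (is_derive_affine 1 0 y)
     (is_deriveM1 _ _ _ _ _ (is_derive_affine (- 1 / 6) (1 / 2) y) (is_derive_affine 1
       0 y))).
  set F := (fun z => _) => d.
  have := is_deriveD d (is_derive_affine 1 (- 1) y) => d'.
  rewrite (_ : (fun z : R => _) = F \+ (fun z => z * 1 - 1)).
    by apply: (is_derive_eq d'); field.
  by apply/funext => z; rewrite /F /=; field.
- by move=> y y0; rewrite subr_ge0 expRN_le2.
Qed.

End expR_bounds.

(** * Slope at 1 of the subcritical generating function *)

Section derivative_at_one.
Context {R : realType}.
Variable alpha : R.
Hypothesis alpha_ge0 : 0 <= alpha.
Implicit Types t : R.

(** The normalised second-order remainder: [expR (- (alpha * t))] is [1 - alpha * t + w t * t ^+ 2],
    and [w t] tends to [alpha ^+ 2 / 2] at 0. *)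
Let w t : R := (expR (- (alpha * t)) - 1 + alpha * t) / t ^+ 2.

Let w_bounds t : 0 < t -> alpha ^+ 2 / 2 - alpha ^+ 3 / 6 * t <= w t <= alpha ^+ 2 / 2.
Proof.
move=> t0; have at0 : 0 <= alpha * t by rewrite mulr_ge0// ltW.
have t2 : 0 < t ^+ 2 by rewrite exprn_gt0.
have := expRN_le2 _ at0; have := expRN_ge3 _ at0; rewrite !exprMn => lo up.
rewrite /w ler_pdivlMr// ler_pdivrMr//; apply/andP; split; last by lra.
by rewrite [leLHS](_ : _ = alpha ^+ 2 * t ^+ 2 / 2 - alpha ^+ 3 * t ^+ 3 / 6);
  [lra|field].
Qed.

Definition subcritical_pgf (s : R) : R :=
  1 - alpha - s * (2 - alpha) + 2 * s ^+ 2 * expR (alpha * (1 - s))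
  + 2 * s * expR (alpha * (1 - s)) * Num.sqrt (pgf_radicand alpha (1 - alpha) s).

(** Written with [w], the radicand has the factor [t ^+ 2] and the remaining numerator the factor
    [t], so the quotient has no singularity left at 0. *)
Let slopeE t : 0 < t -> (1 - subcritical_pgf (1 - t)) / t =
  alpha + 2 - 2 * t - 2 * (expR (alpha * t) * (alpha - w t * t) * (1 - t) ^+ 2)
  - 2 * ((1 - t) * expR (alpha * t) *
    Num.sqrt (1 - 2 * alpha + alpha ^+ 2 - w t * (1 - (2 - alpha) * t))).
Proof.
move=> t0; have t_neq0 : t != 0 by rewrite gt_eqF.
have EE : expR (- (alpha * t)) = 1 - alpha * t + w t * t ^+ 2 by rewrite /w; field.
have eE : expR (alpha * t) = 1 + expR (alpha * t) * (t * (alpha - w t * t)).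
  have : expR (alpha * t) * expR (- (alpha * t)) = 1 by rewrite -expRD subrr expR0.
  by rewrite EE => e1; rewrite -{1}e1; ring.
have radE : pgf_radicand alpha (1 - alpha) (1 - t) =
    t ^+ 2 * (1 - 2 * alpha + alpha ^+ 2 - w t * (1 - (2 - alpha) * t)).
  rewrite /pgf_radicand (_ : alpha * (1 - t - 1) = - (alpha * t)); last by ring.
  by rewrite EE; ring.
rewrite /subcritical_pgf radE sqrtrM ?sqr_ge0// sqrtr_sqr gtr0_norm//.
rewrite (_ : alpha * (1 - (1 - t)) = alpha * t); last by ring.
set S := Num.sqrt _; move: eE; set e := expR _ => eE.
transitivity (((2 - (2 - alpha) * t) - 2 * (1 - t) ^+ 2 * e) / t - 2 * ((1 - t) * e * S)).
  by field.
congr (_ - _); rewrite {1}eE; field.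
by [].
Qed.

Lemma cvg_slope (t : nat -> R) : (forall n, 0 < t n) -> t n @[n --> \oo] --> 0 ->
  (1 - subcritical_pgf (1 - t n)) / t n @[n --> \oo] -->
  2 - alpha - Num.sqrt (2 * (alpha ^+ 2 - 4 * alpha + 2)).
Proof.
move=> t_gt0 t0.
rewrite (_ : (fun n => _) = fun n =>
  alpha + 2 - 2 * t n
  - 2 * (expR (alpha * t n) * (alpha - w (t n) * t n) * (1 - t n) ^+ 2)
  - 2 * ((1 - t n) * expR (alpha * t n) *
    Num.sqrt (1 - 2 * alpha + alpha ^+ 2 - w (t n) * (1 - (2 - alpha) * t n))));
      last first.
  by apply/funext => n; rewrite slopeE.
have cw : w (t n) @[n --> \oo] --> alpha ^+ 2 / 2.
  apply: (@squeeze_cvgr _ _ _ _ (fun n => alpha ^+ 2 / 2 - alpha ^+ 3 / 6 * t n)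
    (fun=> alpha ^+ 2 / 2)); first by apply: nearW => n; exact: w_bounds.
    rewrite -[X in _ --> X]subr0 -[X in _ - X](mulr0 (alpha ^+ 3 / 6)).
    by apply: cvgB; [exact: cvg_cst|apply: cvgM => //; exact: cvg_cst].
  exact: cvg_cst.
have c1t : 1 - t n @[n --> \oo] --> (1 : R).
  by rewrite -[X in _ --> X](@subr0 R 1); apply: cvgB => //; exact: cvg_cst.
have ce : expR (alpha * t n) @[n --> \oo] --> (1 : R).
  rewrite -[X in _ --> X](@expR0 R) -[X in expR X](mulr0 alpha).
  apply: continuous_cvg; first exact: continuous_expR.
  by apply: cvgM => //; exact: cvg_cst.
(* The limit is spelled out in the shape of [slopeE], so that convergence is proved factor by
   factor. *)
rewrite (_ : 2 - alpha - _ = alpha + 2 - 2 * 0 - 2 * (1 * (alpha - alpha ^+ 2 / 2 * 0)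
  * 1 ^+ 2)
  - 2 * (1 * 1 * Num.sqrt (1 - 2 * alpha + alpha ^+ 2 - alpha ^+ 2 / 2 * (1 - (2 -
    alpha) * 0)))).
  have cst r : (fun=> r) n @[n --> \oo] --> (r : R) by exact: cvg_cst.
  apply: cvgB; [apply: cvgB|].
  - by apply: cvgB => //; exact: cvgM.
  - apply: cvgM => //; apply: cvgM.
      by apply: cvgM => //; apply: cvgB => //; exact: cvgM.
    by rewrite expr2; under eq_cvg do rewrite expr2; exact: cvgM.
  - apply: cvgM => //; apply: cvgM; first exact: cvgM.
    apply: continuous_cvg; first exact: sqrt_continuous.
    apply: cvgB => //; apply: cvgM => //; apply: cvgB => //.
    exact: cvgM.
have -> : 2 * (alpha ^+ 2 - 4 * alpha + 2) = 2 ^+ 2 *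
  (1 - 2 * alpha + alpha ^+ 2 - alpha ^+ 2 / 2 * (1 - (2 - alpha) * 0)) by field.
by rewrite sqrtrM ?sqr_ge0// sqrtr_sqr ger0_norm//; ring.
Qed.

End derivative_at_one.

(** * The mean as the slope of the generating function at 1 *)

Section mean_visits.
Context {d : measure_display} {Omega : measurableType d} {R : realType}
  {P : probability Omega R}.
Variable X : {RV P >-> nat}.

Let mX := measurable_RVnat X.

Lemma pgf0E : pgf P X 0 = fine (P [set w | X w = 0%N]).
Proof.
rewrite /pgf /mean; congr fine.
transitivity (\int[P]_w (\1_[set w | X w = 0%N] w)%:E)%E.
  apply: eq_integral => w _; congr (_%:E); rewrite indicE expr0n.
  by case: eqP => [e|ne]; [rewrite mem_set|rewrite memNset].
by rewrite integral_indic ?setIT.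
Qed.

Lemma integral_onem_expr (s : R) : 0 <= s <= 1 ->
  (\int[P]_w (1 - s ^+ X w)%:E)%E = (1 - pgf P X s)%:E.
Proof.
move=> s01.
have s01n w : 0 <= s ^+ X w <= 1 by exact: exprn_itv.
have ms : measurable_fun setT (fun w => s ^+ X w).
  exact: (measurable_comp_nat _ mX (fun k => s ^+ k)).
have ms1 : measurable_fun setT (fun w => 1 - s ^+ X w).
  exact: (measurable_comp_nat _ mX (fun k => 1 - s ^+ k)).
have s01n' w : 0 <= 1 - s ^+ X w <= 1 by have := s01n w; lra.
rewrite integral_mean//; congr (_%:E).
apply/eqP; rewrite eq_sym subr_eq /pgf -meanD//.
by apply/eqP; rewrite -[LHS](mean_cst (P := P)); apply: eq_mean => w; rewrite subrK.
Qed.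

Lemma geometric_sumE (s : R) n : 1 - s ^+ n = (1 - s) * \sum_(i < n) s ^+ i.
Proof. by rewrite -opprB subrX1 -mulNr opprB. Qed.

(** Each of the [n] terms of the geometric sum [(1 - s ^+ n) / (1 - s)] is at most 1. *)
Lemma mean_visits_ge (s : R) : 0 <= s <= 1 ->
  ((1 - pgf P X s)%:E <= (1 - s)%:E * \int[P]_w (X w)%:R%:E)%E.
Proof.
move=> s01; rewrite -integral_onem_expr// -ge0_integralZl//; first last.
- by rewrite lee_fin; lra.
- by apply/measurable_EFinP; exact: (measurable_comp_nat _ mX (fun k => k%:R)).
apply: ge0_le_integral => //.
- by move=> w _; rewrite lee_fin; have := exprn_itv _ (X w) s01; lra.
- apply/measurable_EFinP; exact: (measurable_comp_nat _ mX (fun k => 1 - s ^+ k)).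
- apply/measurable_EFinP; exact: (measurable_comp_nat _ mX (fun k => (1 - s) * k%:R)).
- move=> w _; rewrite -EFinM lee_fin geometric_sumE ler_wpM2l//; first lra.
  rewrite -[X in _ <= X%:R](card_ord (X w)) -sumr_const.
  by apply: ler_sum => i _; case/andP: (exprn_itv _ i s01).
Qed.

Lemma mean_visits_infty :
  (forall m : R, 0 <= m -> exists2 s : R, 0 < s < 1 & pgf P X s < 1 - m * (1 - s)) ->
  (\int[P]_w (X w)%:R%:E)%E = +oo%E.
Proof.
move=> steep.
have ge0 : (0 <= \int[P]_w (X w)%:R%:E)%E by apply: integral_ge0 => w _; rewrite lee_fin.
case E : (\int[P]_w (X w)%:R%:E)%E ge0 => [r| |]//; rewrite lee_fin => r0.
have [s s01 Gs] := steep r r0.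
have s01' : 0 <= s <= 1 by lra.
by have := mean_visits_ge s s01'; rewrite E -EFinM lee_fin => h; exfalso; clear E; lra.
Qed.

(** The quotient [(1 - s ^+ X) / (1 - s)] is the sum of the [s ^+ i] for [i < X], which increases to
    [X] as [s] increases to 1; monotone convergence applies. *)
Lemma mean_visits_limit (L : R) :
  (1 - pgf P X (1 - n.+1%:R^-1)) / n.+1%:R^-1 @[n --> \oo] --> L ->
  (\int[P]_w (X w)%:R%:E)%E = L%:E.
Proof.
move=> cL.
pose t (n : nat) : R := n.+1%:R^-1.
have t01 n : 0 < t n <= 1 by rewrite /t invr_gt0 ltr0Sn /= invf_le1 ?ler1n ?ltr0Sn.
pose g n w : R := (1 - (1 - t n) ^+ X w) / t n.
have gE n w : g n w = \sum_(i < X w) (1 - t n) ^+ i.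
  rewrite /g geometric_sumE subKr mulrAC divff ?mul1r// gt_eqF//.
  by case/andP: (t01 n).
have nt01 n : 0 <= 1 - t n <= 1 by have := t01 n; lra.
have mg n : measurable_fun setT (fun w => (g n w)%:E).
  apply/measurable_EFinP.
  exact: (measurable_comp_nat _ mX (fun k => (1 - (1 - t n) ^+ k) / t n)).
have g0 n w : setT w -> (0 <= (g n w)%:E)%E.
  move=> _; rewrite lee_fin gE sumr_ge0// => i _.
  by case/andP: (exprn_itv _ i (nt01 n)).
have ndg w : setT w -> {homo (fun n => (g n w)%:E) : m n / (m <= n)%N >-> (m <= n)%E}.
  move=> _ m n mn; rewrite lee_fin !gE; apply: ler_sum => i _.
  apply: lerXn2r; rewrite ?nnegrE; [by case/andP: (nt01 m)|by case/andP: (nt01 n)|].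
  by rewrite lerD2l lerN2 /t lef_pV2 ?posrE ?ltr0n// ler_nat.
have := @cvg_monotone_convergence _ _ _ P _ measurableT _ mg g0 ndg.
have -> : (fun n => \int[P]_w (g n w)%:E)%E = (fun n => ((1 - pgf P X (1 - t n)) / t
  n)%:E).
  apply/funext => n; rewrite /g.
  under eq_integral do rewrite mulrC EFinM.
  rewrite ge0_integralZl//.
  - by rewrite integral_onem_expr// -EFinM mulrC.
  - by apply/measurable_EFinP; exact: (measurable_comp_nat _ mX (fun k => 1 - (1 - t n)
    ^+ k)).
  - by move=> w _; rewrite lee_fin; have := exprn_itv _ (X w) (nt01 n); lra.
  - by rewrite lee_fin invr_ge0; have := t01 n; lra.
have c1 : 1 - t n @[n --> \oo] --> (1 : R).
  rewrite -[X in _ --> X](@subr0 R 1); apply: cvgB; first exact: cvg_cst.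
  exact: cvg_harmonic.
have glim w : limn (fun n => (g n w)%:E) = (X w)%:R%:E.
  apply/cvg_lim => //; apply: cvg_EFin; first exact: nearW.
  rewrite (_ : _ \o _ = fun n => \sum_(i < X w) (1 - t n) ^+ i); last first.
    by apply/funext => n /=; rewrite gE.
  elim: (X w) => [|k IHk].
    by under eq_cvg do rewrite big_ord0; exact: cvg_cst.
  under eq_cvg do rewrite big_ord_recr; rewrite -natr1.
  apply: cvgD => //; rewrite -[X in _ --> X](expr1n R k).
  by apply: (@continuous_cvg _ _ _ _ _ _ (fun x : R => x ^+ k));
    first exact: exprn_continuous.
under eq_integral do rewrite glim.
move=> c; apply: (cvg_unique _ c) => //.
by apply: cvg_EFin => //; exact: nearW.
Qed.

End mean_visits.

Theorem theorem3p2 (R : realType) (alpha : R) (alpha_ge0 : 0 <= alpha)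
    (d : measure_display) (Omega : measurableType d) (P : probability Omega R)
    (N C : vertex -> {RV P >-> nat}) (X : {RV P >-> nat})
    (NC : bgw_parking alpha N C) (XE : counts_root_visits N C X) :
  let p : R := fine (P [set w | X w = 0%N]) in
  let G (s : R) : \bar R := ('E_P[fun w => (s ^+ X w)%R])%E in
  let EX : \bar R := ('E_P[fun w => (X w)%:R])%E in
  [/\ alpha <= 2 - Num.sqrt 2 ->
      [/\ forall s : R, 0 <= s <= 1 ->
            let radicand := s ^+ 2
              - expR (alpha * (s - 1)) * (s * (2 - alpha) - (1 - alpha)) in
            0 <= radicand /\
            G s = (1 - alpha - s * (2 - alpha)
                   + 2 * s ^+ 2 * expR (alpha * (1 - s))
                   + 2 * s * expR (alpha * (1 - s)) * Num.sqrt radicand)%:E,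
          p = 1 - alpha
        & EX = (2 - alpha
                - Num.sqrt (2 * (alpha ^+ 2 - 4 * alpha + 2)))%:E ],
      2 - Num.sqrt 2 < alpha ->
      [/\ 0 <= s_discr alpha p,
          forall s : R, 0 <= s <= 1 ->
            let radicand := s ^+ 2
              - expR (alpha * (s - 1)) * (s * (1 + p) - p) in
            0 <= radicand /\
            G s = (p - s * (1 + p) + 2 * s ^+ 2 * expR (alpha * (1 - s))
                   + (if s <= s_crit alpha p then
                        2 * s * expR (alpha * (1 - s)) * Num.sqrt radicand
                      else
                        - (2 * s * expR (alpha * (1 - s))
                           * Num.sqrt radicand)))%:E,
          1 - alpha < p
        & EX = +oo%E ]
    & 2 - Num.sqrt 2 < alpha ->
      Num.max (expR (- alpha) / 4) (1 - alpha) < p < c_bound alpha ].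
Proof.
move=> p G EX.
pose g (s : R) := pgf P X s.
have g01 (s : R) : 0 <= s <= 1 -> 0 <= g s <= 1 := pgf_itv X (measurable_RVnat X) s.
have g_lip := pgf_lip (P := P) X (measurable_RVnat X).
have g_near0 := pgf_near0 (P := P) X (measurable_RVnat X).
have g_quad := pgf_quadratic N C alpha_ge0 NC X XE.
have pE : p = g 0 by rewrite /p -pgf0E.
have GE (s : R) : 0 <= s <= 1 -> G s = (g s)%:E.
  by move=> s01; rewrite /G unlock integral_pgf//; exact: measurable_RVnat.
have EXE : EX = (\int[P]_w (X w)%:R%:E)%E by rewrite /EX unlock.
have rad_ge0 := radicand_ge0 alpha g g01 g_quad.
(* At 1 the root vanishes and either sign is correct; the sign lemmas cover only [s < 1]. *)
have b1 : branch alpha g 1 = 0.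
  apply/eqP; rewrite -sqrf_eq0 (branch_sqr alpha g g_quad) ?pgf_radicand1//.
  by rewrite ltr01 lexx.
split.
- move=> a2.
  have p1a : g 0 = 1 - alpha := pgf_subcritical alpha g alpha_ge0 g01 g_lip g_near0
    g_quad a2.
  have gE (s : R) : 0 <= s <= 1 -> g s = subcritical_pgf alpha s.
    move=> s01; rewrite /subcritical_pgf -p1a.
    (* At [s = 0], where [branch] would divide by 0, the formula is checked directly. *)
    have [->|s0] := eqVneq s 0; first by rewrite !mul0r expr0n /= !mulr0 !mul0r; ring.
    have s01' : 0 < s <= 1 by rewrite lt_def s0.
    rewrite (pgf_sqrtE alpha g g_quad _ s01'); first by rewrite p1a; ring.
    have [->|s1] := eqVneq s 1; first by rewrite b1.
    apply/ltW/(branch_pos_subcritical alpha g) => //.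
    by case/andP: s01' => -> s_le1; rewrite lt_neqAle s1.
  have radE (s : R) : s ^+ 2 - expR (alpha * (s - 1)) * (s * (2 - alpha) - (1 - alpha)) =
      pgf_radicand alpha (1 - alpha) s by rewrite /pgf_radicand; ring.
  split.
  + move=> s s01 radicand; rewrite /radicand radE GE// gE//; split => //.
    by rewrite -p1a; exact: rad_ge0.
  + by rewrite pE.
  + rewrite EXE; apply: mean_visits_limit.
    rewrite (_ : (fun n => _) = fun n =>
        (1 - subcritical_pgf alpha (1 - n.+1%:R^-1)) / n.+1%:R^-1); last first.
      apply/funext => n; rewrite -gE// subr_ge0 gerBl invr_ge0 ler0n andbT.
      by rewrite invf_le1 ?ler1n ?ltr0Sn.
    apply: (cvg_slope alpha alpha_ge0 (fun n => n.+1%:R^-1)) => [n|].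
      by rewrite invr_gt0 ltr0Sn.
    exact: cvg_harmonic.
- move=> a2.
  have [sc01 disc bpos bneg _] := supercritical_zero alpha g alpha_ge0 g01 g_lip
    g_near0 g_quad a2.
  have ap : 1 - alpha < g 0 by exact: (p_gt_supercritical alpha g).
  rewrite pE; split => //.
  + exact: ltW.
  + move=> s s01 radicand; rewrite GE//; split; first exact: rad_ge0.
    rewrite /radicand -/(pgf_radicand alpha (g 0) s); congr (_%:E).
    have [s_le|s_gt] := leP.
      have [->|s0] := eqVneq s 0; first by rewrite !mul0r expr0n /= !mulr0 !mul0r; ring.
      have s01' : 0 < s <= 1 by rewrite lt_def s0.
      rewrite (pgf_sqrtE alpha g g_quad _ s01')//; apply: bpos; lra.
    have s01' : 0 < s <= 1 by lra.
    rewrite (pgf_sqrtNE alpha g g_quad _ s01')//.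
    have [->|s1] := eqVneq s 1; first by rewrite b1.
    apply: bneg; rewrite s_gt/= lt_neqAle s1; lra.
  + rewrite EXE; apply: mean_visits_infty.
    exact: (pgf_steep_at1 alpha g).
- move=> a2; rewrite pE gt_max.
  rewrite (p_lower alpha g) ?(p_gt_supercritical alpha g) ?(p_lt_c_bound alpha g)//.
Qed.
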